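(* The theories $\mathrm{STT}^\uparrow$ and $\mathrm{CTT}^\omega$ are definitionally equivalent.
   Context: $\mathrm{CTT}^\omega$: cumulative type theory with types $n<\omega$; atomic formulas $y^n(x^m)$ well-formed iff $m<n$, and $a^n=b^n$ (same type); classical natural deduction with usual identity rules at each type; quantifier rules: for $m\le n$, from $\forall x^n\phi(x^n)$ infer $\phi(a^m)$, and from $\phi(b^n)$ infer $\forall x^m\phi(x^m)$ (all expressions well-formed, $b^n$ not in undischarged assumptions); dually for $\exists$. Comprehension: $\exists z^{n+1}\forall x^n(z^{n+1}(x^n)\leftrightarrow\phi(x^n))$ for well-formed $\phi$ not containing $z^{n+1}$. Defined ($k=\max(m,n)+1$): $a^m\equiv b^n:\Leftrightarrow\forall x^k(x^k(a^m)\leftrightarrow x^k(b^n))$, $a^m\,\hat\in\,b^n:\Leftrightarrow\exists x^k(x^k\equiv b^n\wedge x^k(a^m))$. Axioms: Type-Founded $\forall a^m\forall b^{n+1}(a^m\,\hat\in\,b^{n+1}\to\exists x^n\,a^m\equiv x^n)$; Type-Base $\forall x^0\forall y^m\neg(y^m\,\hat\in\,x^0)$. $\mathrm{STT}$: types $n<\omega$; $b^n(a^m)$ well-formed iff $n=m+1$; identity only between same-type terms; quantifier rules only instantiate/generalise at the same type; Comprehension $\exists z^{n+1}\forall x^n(z^{n+1}(x^n)\leftrightarrow\phi(x^n))$ ($\phi$ not containing $z^{n+1}$); identity scheme $x^n=y^n\leftrightarrow\forall z^{n+1}(z^{n+1}(x^n)\leftrightarrow z^{n+1}(y^n))$. $\mathrm{STT}^\uparrow$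 adds, for each $n$, a function symbol $\uparrow$ taking type-$n$ terms to type-$(n+1)$ terms, extends Comprehension to formulas containing $\uparrow$, and adds axioms: Up-Inject $\forall x^n\forall y^n(\uparrow x^n=\uparrow y^n\to x^n=y^n)$; Up-Possess $\forall x^n\forall y^{n+1}(\uparrow y^{n+1}(\uparrow x^n)\leftrightarrow y^{n+1}(x^n))$; Up-Founded $\forall x^{n+1}\forall y^{n+1}(\uparrow y^{n+1}(x^{n+1})\to\exists z^n\,x^{n+1}=\uparrow z^n)$; Up-Base $\forall x^0\forall y^0\neg\uparrow y^0(x^0)$. Two theories are definitionally equivalent iff there are interpretations (type-respecting translations preserving logical vocabulary and taking theorems to theorems) $I$ from the first to the second and $J$ from the second to the first such that each theory proves every formula equivalent to its translation under the composite of the two interpretations (and, for function symbols, proves the terms equal to their double translations). *)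

(* Defs.v *)
From HB Require Import structures.
From mathcomp Require Import all_boot.
Set Implicit Arguments.
Unset Strict Implicit.
Unset Printing Implicit Defensive.

(** * Typed syntax

    Locally nameless: [FV n i] is the [i]-th free variable (parameter) of type
    [n]; bound variables are de Bruijn indices, whose types are recorded by the
    binding quantifiers and, for an open expression, by an environment
    [G : seq nat] listing the types of the dangling indices [0, 1, 2, ...].
    Having infinitely many parameters of each type, independently of any
    environment, the logic proves each type inhabited, as ordinary natural
    deduction does. *)

Inductive term : Type :=
  | BV (k : nat)
  | FV (n i : nat)
  | Up (t : term).

(** [Pred t s] is the predication t(s). *)
Inductive form : Type :=
  | Bot
  | Pred (t s : term)
  | Eq (t s : term)
  | Imp (p q : form)
  | And (p q : form)
  | Or (p q : form)
  | All (n : nat) (p : form)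
  | Ex (n : nat) (p : form).

Definition Not (p : form) : form := Imp p Bot.
Definition Iff (p q : form) : form := And (Imp p q) (Imp q p).

Lemma form_comparable : comparable form.
Proof. by move=> x y; rewrite /decidable; repeat decide equality. Qed.
HB.instance Definition _ := hasDecEq.Build form (compareP form_comparable).

Fixpoint tsubst (f : nat -> term) (t : term) : term :=
  match t with
  | BV k => f k
  | FV n i => FV n i
  | Up s => Up (tsubst f s)
  end.

Definition shift : term -> term := tsubst (fun k => BV k.+1).

Definition up (f : nat -> term) (k : nat) : term :=
  if k is j.+1 then shift (f j) else BV 0.

Fixpoint subst (f : nat -> term) (p : form) : form :=
  match p with
  | Bot => Bot
  | Pred t s => Pred (tsubst f t) (tsubst f s)
  | Eq t s => Eq (tsubst f t) (tsubst f s)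
  | Imp p q => Imp (subst f p) (subst f q)
  | And p q => And (subst f p) (subst f q)
  | Or p q => Or (subst f p) (subst f q)
  | All n p => All n (subst (up f) p)
  | Ex n p => Ex n (subst (up f) p)
  end.

(** φ(a), where φ(x) is [p] with x the index 0. *)
Definition inst (a : term) (p : form) : form :=
  subst (fun k => if k is j.+1 then BV j else a) p.

(** Insert a fresh dangling index at position 1, leaving index 0 alone. *)
Definition lift1 (p : form) : form :=
  subst (fun k => if k is j.+1 then BV j.+2 else BV 0) p.

Fixpoint tfv (t : term) : seq (nat * nat) :=
  match t with
  | BV _ => [::]
  | FV n i => [:: (n, i)]
  | Up s => tfv s
  end.

Fixpoint fv (p : form) : seq (nat * nat) :=
  match p with
  | Bot => [::]
  | Pred t s | Eq t s => tfv t ++ tfv s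
  | Imp p q | And p q | Or p q => fv p ++ fv q
  | All _ p | Ex _ p => fv p
  end.

Definition fvs (D : seq form) : seq (nat * nat) := flatten (map fv D).

(** * Type disciplines *)

Record discipline : Type := Discipline {
  (* b^n(a^m) is well-formed *)
  pred_ok : nat -> nat -> bool;
  (* ↑ belongs to the language *)
  up_ok : bool;
  (* the quantifier rules may relate a term of type m to a bound variable of
     type n *)
  inst_ok : nat -> nat -> bool }.

Fixpoint ty (G : seq nat) (t : term) : nat :=
  match t with
  | BV k => nth 0 G k
  | FV n _ => n
  | Up s => (ty G s).+1
  end.

Fixpoint wft (L : discipline) (G : seq nat) (t : term) : bool :=
  match t with
  | BV k => k < size G
  | FV _ _ => true
  | Up s => up_ok L && wft L G s
  end.

Fixpoint wf (L : discipline) (G : seq nat) (p : form) : bool :=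
  match p with
  | Bot => true
  | Pred t s => [&& wft L G t, wft L G s & pred_ok L (ty G t) (ty G s)]
  | Eq t s => [&& wft L G t, wft L G s & ty G t == ty G s]
  | Imp p q | And p q | Or p q => wf L G p && wf L G q
  | All n p | Ex n p => wf L (n :: G) p
  end.

(** * Classical natural deduction with identity *)

(** [ded L Ax D p]: [p] is derivable from the axioms [Ax] and undischarged
    assumptions [D].  In [AllI] and [ExE] the eigenvariable [FV n i] may have a
    type different from the type [m] of the bound variable, so φ(b^n) and φ(x^m)
    must both be well-formed; as usual, it may not occur in φ(x) itself. *)
Inductive ded (L : discipline) (Ax : form -> Prop) :
    seq form -> form -> Prop :=
  | Hyp D p : p \in D -> wf L [::] p -> ded L Ax D p
  | Axm D p : Ax p -> wf L [::] p -> ded L Ax D p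
  | ImpI D p q : wf L [::] p -> ded L Ax (p :: D) q -> ded L Ax D (Imp p q)
  | ImpE D p q : ded L Ax D (Imp p q) -> ded L Ax D p -> ded L Ax D q
  | AndI D p q : ded L Ax D p -> ded L Ax D q -> ded L Ax D (And p q)
  | AndE1 D p q : ded L Ax D (And p q) -> ded L Ax D p
  | AndE2 D p q : ded L Ax D (And p q) -> ded L Ax D q
  | OrI1 D p q : wf L [::] q -> ded L Ax D p -> ded L Ax D (Or p q)
  | OrI2 D p q : wf L [::] p -> ded L Ax D q -> ded L Ax D (Or p q)
  | OrE D p q r : ded L Ax D (Or p q) ->
      ded L Ax (p :: D) r -> ded L Ax (q :: D) r -> ded L Ax D r
  | RAA D p : wf L [::] p -> ded L Ax (Not p :: D) Bot -> ded L Ax D p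
  | AllI D m n i p : inst_ok L m n ->
      (n, i) \notin fvs D -> (n, i) \notin fv p ->
      wf L [::] (All m p) ->
      ded L Ax D (inst (FV n i) p) -> ded L Ax D (All m p)
  | AllE D n p a : inst_ok L (ty [::] a) n ->
      wft L [::] a -> wf L [::] (inst a p) ->
      ded L Ax D (All n p) -> ded L Ax D (inst a p)
  | ExI D n p a : inst_ok L (ty [::] a) n ->
      wft L [::] a -> wf L [::] (Ex n p) ->
      ded L Ax D (inst a p) -> ded L Ax D (Ex n p)
  | ExE D m n i p q : inst_ok L m n ->
      (n, i) \notin fvs D -> (n, i) \notin fv p -> (n, i) \notin fv q ->
      wf L [::] (inst (FV n i) p) ->
      ded L Ax D (Ex m p) -> ded L Ax (inst (FV n i) p :: D) q ->
      ded L Ax D q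
  | EqI D a : wft L [::] a -> ded L Ax D (Eq a a)
  | EqE D p a b : wf L [::] (inst b p) ->
      ded L Ax D (Eq a b) -> ded L Ax D (inst a p) -> ded L Ax D (inst b p).

Record theory : Type := Theory {
  lang : discipline;
  axioms : form -> Prop }.

Definition thm (T : theory) (p : form) : Prop :=
  ded (lang T) (axioms T) [::] p.

(** ∃z^{n+1} ∀x^n (z(x) ↔ φ(x)).  When [p] is well-formed in the environment
    [[:: n]], its only dangling index is that of x, so z is not in it. *)
Definition comprehension (n : nat) (p : form) : form :=
  Ex n.+1 (All n (Iff (Pred (BV 1) (BV 0)) p)).

(** * Cumulative type theory *)

Definition cumulative : discipline :=
  Discipline (fun n m => m < n) false (fun m n => m <= n).

(** a^m ≡ b^n *)
Definition Equiv (m n : nat) (a b : term) : form :=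
  All (maxn m n).+1 (Iff (Pred (BV 0) (shift a)) (Pred (BV 0) (shift b))).

(** a^m ∈̂ b^n *)
Definition HatIn (m n : nat) (a b : term) : form :=
  let k := (maxn m n).+1 in
  Ex k (And (Equiv k n (BV 0) (shift b)) (Pred (BV 0) (shift a))).

Inductive CTT_axiom : form -> Prop :=
  | CTT_comprehension n p : wf cumulative [:: n] p ->
      CTT_axiom (comprehension n p)
  | Type_Founded m n : CTT_axiom
      (All m (All n.+1 (Imp (HatIn m n.+1 (BV 1) (BV 0))
                            (Ex n (Equiv m n (BV 2) (BV 0))))))
  | Type_Base m : CTT_axiom
      (All 0 (All m (Not (HatIn m 0 (BV 0) (BV 1))))).

Definition CTTomega : theory := Theory cumulative CTT_axiom.

(** * Simple type theory with ↑ *)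

Definition simple_up : discipline :=
  Discipline (fun n m => n == m.+1) true (fun m n => m == n).

Inductive STTup_axiom : form -> Prop :=
  | STT_comprehension n p : wf simple_up [:: n] p ->
      STTup_axiom (comprehension n p)
  | STT_identity n : STTup_axiom
      (All n (All n (Iff (Eq (BV 1) (BV 0))
        (All n.+1 (Iff (Pred (BV 0) (BV 2)) (Pred (BV 0) (BV 1)))))))
  | Up_Inject n : STTup_axiom
      (All n (All n (Imp (Eq (Up (BV 1)) (Up (BV 0))) (Eq (BV 1) (BV 0)))))
  | Up_Possess n : STTup_axiom
      (All n (All n.+1 (Iff (Pred (Up (BV 0)) (Up (BV 1)))
                            (Pred (BV 0) (BV 1)))))
  | Up_Founded n : STTup_axiom
      (All n.+1 (All n.+1 (Imp (Pred (Up (BV 0)) (BV 1))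
                               (Ex n (Eq (BV 2) (Up (BV 0)))))))
  | Up_Base : STTup_axiom
      (All 0 (All 0 (Not (Pred (Up (BV 0)) (BV 1))))).

Definition STTup : theory := Theory simple_up STTup_axiom.

(** * Interpretations *)

(** [ipred n m] translates the predication of y^n to x^m; its dangling indices
    are 0 for x^m and 1 for y^n.  [iup n] translates ↑x^n = y^{n+1}, i.e.
    defines the graph of ↑ at type n; its dangling indices are 0 for y^{n+1}
    and 1 for x^n. *)
Record translation : Type := Translation {
  ipred : nat -> nat -> form;
  iup : nat -> form }.

(** Translation of "φ holds of the value of t", where φ is [p] with index 0 for
    that value, and [G] types the dangling indices of [t]: function symbols are
    removed innermost first, φ(↑s) becoming ∃y (↑s = y ∧ φ(y)). *)
Fixpoint tr_at (I : translation) (G : seq nat) (t : term) (p : form) : form :=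
  if t is Up s
  then tr_at I G s (Ex (ty G s).+1 (And (iup I (ty G s)) (lift1 p)))
  else inst t p.

(** The logical vocabulary, identity included, is kept fixed, and quantifiers
    keep their types. *)
Fixpoint tr (I : translation) (G : seq nat) (p : form) : form :=
  match p with
  | Bot => Bot
  | Pred t s =>
      tr_at I G t (tr_at I (ty G t :: G) (shift s) (ipred I (ty G t) (ty G s)))
  | Eq t s => tr_at I G t (tr_at I (ty G t :: G) (shift s) (Eq (BV 1) (BV 0)))
  | Imp p q => Imp (tr I G p) (tr I G q)
  | And p q => And (tr I G p) (tr I G q)
  | Or p q => Or (tr I G p) (tr I G q)
  | All n p => All n (tr I (n :: G) p)
  | Ex n p => Ex n (tr I (n :: G) p)
  end.

(** ∃!y^n φ, where φ is [p] with y the index 0. *)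
Definition ExUnique (n : nat) (p : form) : form :=
  Ex n (And p (All n (Imp (lift1 p) (Eq (BV 0) (BV 1))))).

(** A defining formula has no free variables besides its dangling indices. *)
Definition defining (L : discipline) (G : seq nat) (p : form) : Prop :=
  wf L G p /\ fv p = [::].

Definition interpretation (T1 T2 : theory) (I : translation) : Prop :=
  [/\ forall n m, pred_ok (lang T1) n m ->
        defining (lang T2) [:: m; n] (ipred I n m),
      up_ok (lang T1) -> forall n,
        defining (lang T2) [:: n.+1; n] (iup I n) /\
        thm T2 (All n (ExUnique n.+1 (iup I n)))
    & forall p, wf (lang T1) [::] p -> thm T1 p -> thm T2 (tr I [::] p)].

(** [T] proves every formula equivalent to its image under [I] then [J], and
    the value of ↑ equal to the value of its doubly translated version. *)
Definition round_trip (T : theory) (I J : translation) : Prop :=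
  (forall p, wf (lang T) [::] p ->
     thm T (Iff p (tr J [::] (tr I [::] p)))) /\
  (up_ok (lang T) -> forall n,
     thm T (All n (All n.+1
       (Iff (Eq (Up (BV 1)) (BV 0)) (tr J [:: n.+1; n] (iup I n)))))).

Definition definitionally_equivalent (T1 T2 : theory) : Prop :=
  exists I J : translation,
    [/\ interpretation T1 T2 I, interpretation T2 T1 J,
        round_trip T1 I J & round_trip T2 J I].

(* Main.v *)
From mathcomp Require Import all_boot boolp zify.
Require Import Defs.
Set Implicit Arguments.
Unset Strict Implicit.
Unset Printing Implicit Defensive.

(** Both directions are proved semantically, through a Henkin completeness
    theorem for many-sorted structures that covers both theories at once.

    In a model of [CTTomega] every x^n has exactly one y^{n+1} with x ≡ y: the
    cumulative ∃-rule applied to x ≡ x gives existence, and Leibniz' law (from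
    comprehension) gives uniqueness.  Reading ↑x as this y turns the model into
    one of [STTup].  Conversely, in a model of [STTup], reading y^n(x^m) as
    y^n(↑^{n-m-1} x^m) gives a model of [CTTomega]; the cumulative quantifier
    rules hold there because, by Up-Possess and Up-Inject, a formula that is
    well-formed at both types cannot tell a from ↑a.  Each construction undoes
    the other, and translated formulas express truth in the constructed model,
    so completeness turns these facts into derivations. *)

Definition scons (A : Type) (a : A) (f : nat -> A) (k : nat) : A :=
  if k is j.+1 then f j else a.

(** * Substitution and typing *)

Lemma tsubst_id t : tsubst BV t = t.
Proof. by elim: t => //= t ->. Qed.

Lemma tsubst_comp f g t : tsubst g (tsubst f t) = tsubst (tsubst g \o f) t.
Proof. by elim: t => //= t ->. Qed.

Lemma tsubst_shift f t : tsubst (up f) (shift t) = shift (tsubst f t).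
Proof. by rewrite /shift !tsubst_comp. Qed.

Lemma up_id : up BV = BV.
Proof. by apply/funext; case. Qed.

Lemma up_comp f g : up (tsubst g \o f) = tsubst (up g) \o up f.
Proof. by apply/funext; case=> //= k; rewrite tsubst_shift. Qed.

Lemma subst_id p : subst BV p = p.
Proof. by elim: p => //= [t s|t s|? -> ? ->|? -> ? ->|? -> ? ->|n p|n p];
  rewrite ?tsubst_id ?up_id // => ->. Qed.

Lemma subst_comp p f g : subst g (subst f p) = subst (tsubst g \o f) p.
Proof.
by elim: p f g => //= [t s|t s|p IHp q IHq|p IHp q IHq|p IHp q IHq|n p IHp|n p IHp] f g;
  rewrite ?tsubst_comp ?up_comp ?IHp ?IHq.
Qed.

Lemma inst_subst_up a f p : inst a (subst (up f) p) = subst (scons a f) p.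
Proof.
rewrite /inst subst_comp; congr subst; apply/funext; case=> //= k.
by rewrite /shift tsubst_comp tsubst_id.
Qed.

Lemma wft_closed L G t : wft L [::] t -> wft L G t /\ ty G t = ty [::] t.
Proof. by elim: t => //= t IH /andP[-> /IH[-> ->]]. Qed.

Lemma tsubst_closed L f t : wft L [::] t -> tsubst f t = t.
Proof. by elim: t => //= t IH /andP[_ /IH ->]. Qed.

(** The well-formedness clause is an equality, so indices beyond the environment must go to
    ill-formed terms. Hence [wf_subst] works in both directions, and the well-formedness of φ(x) can
    be read off from that of φ(a). *)
Definition typed_subst (L : discipline) (G G' : seq nat) (f : nat -> term) :=
  forall k, wft L G' (f k) = (k < size G) /\
            (k < size G -> ty G' (f k) = nth 0 G k).

Lemma wft_tsubst L G G' f t : typed_subst L G G' f ->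
  wft L G' (tsubst f t) = wft L G t /\
  (wft L G t -> ty G' (tsubst f t) = ty G t).
Proof.
move=> hf; elim: t => //= t [-> IH]; split=> // /andP[_ /IH ->] //.
Qed.

Lemma typed_shift L n G : typed_subst L G (n :: G) (fun k => BV k.+1).
Proof. by []. Qed.

Lemma typed_up L n G G' f : typed_subst L G G' f ->
  typed_subst L (n :: G) (n :: G') (up f).
Proof.
move=> hf [|k] //=; have [e1 e2] := wft_tsubst (f k) (@typed_shift L n G').
have [h1 h2] := hf k; rewrite /shift e1 h1; split=> // lt_k.
by rewrite e2 ?h2 // h1.
Qed.

Lemma wf_subst L p G G' f : typed_subst L G G' f ->
  wf L G' (subst f p) = wf L G p.
Proof.
elim: p G G' f => //= [t s|t s|p IHp q IHq|p IHp q IHq|p IHp q IHq|n p IHp|n p IHp] G G' f hf.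
1,2: have [e1 e2] := wft_tsubst t hf; have [e3 e4] := wft_tsubst s hf;
  rewrite e1 e3; case: (wft L G t) e2 => //= ->//; case: (wft L G s) e4 => //= ->//.
1,2,3: by rewrite (IHp _ _ _ hf) (IHq _ _ _ hf).
1,2: by apply: IHp; apply: typed_up.
Qed.

Lemma wf_inst L G a p : wft L G a -> wf L G (inst a p) = wf L (ty G a :: G) p.
Proof. by move=> wa; apply: wf_subst => -[|k]. Qed.

Lemma wft_shift L n G t : wft L (n :: G) (shift t) = wft L G t.
Proof. by case: (wft_tsubst t (@typed_shift L n G)). Qed.

Lemma ty_shift n G t : ty (n :: G) (shift t) = ty G t.
Proof. by elim: t => //= t ->. Qed.

Lemma wf_lift1 L n m G p : wf L (n :: m :: G) (lift1 p) = wf L (n :: G) p.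
Proof. by apply: wf_subst => -[|k]. Qed.

Lemma wft_cat L G G' t : wft L G t ->
  wft L (G ++ G') t /\ ty (G ++ G') t = ty G t.
Proof.
elim: t => //= [k lt_k|t IH /andP[-> /IH[-> ->]] //].
by rewrite nth_cat lt_k size_cat ltn_addr.
Qed.

Lemma wf_cat L G G' p : wf L G p -> wf L (G ++ G') p.
Proof.
elim: p G => //= [t s|t s|p IHp q IHq|p IHp q IHq|p IHp q IHq|n p IHp|n p IHp] G.
1,2: by case/and3P=> /(wft_cat G')[-> ->] /(wft_cat G')[-> ->].
1,2,3: by case/andP=> /IHp-> /IHq->.
1,2: exact: IHp (n :: G).
Qed.

(** * Substituting closed terms for parameters *)

(** Intended for maps into closed terms ([typed_psub]), hence no shifting under quantifiers. This
    substitution renames eigenvariables and, in the term model, turns an assignment into a map on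
    formulas. *)
Fixpoint tpsub (s : nat -> nat -> term) (t : term) : term :=
  match t with
  | BV k => BV k
  | FV n i => s n i
  | Up t => Up (tpsub s t)
  end.

Fixpoint psub (s : nat -> nat -> term) (p : form) : form :=
  match p with
  | Bot => Bot
  | Pred t u => Pred (tpsub s t) (tpsub s u)
  | Eq t u => Eq (tpsub s t) (tpsub s u)
  | Imp p q => Imp (psub s p) (psub s q)
  | And p q => And (psub s p) (psub s q)
  | Or p q => Or (psub s p) (psub s q)
  | All n p => All n (psub s p)
  | Ex n p => Ex n (psub s p)
  end.

Definition typed_psub (L : discipline) (s : nat -> nat -> term) :=
  forall n i, wft L [::] (s n i) /\ ty [::] (s n i) = n.

Lemma tpsub_FV t : tpsub FV t = t.
Proof. by elim: t => //= t ->. Qed.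

Lemma psub_FV p : psub FV p = p.
Proof.
by elim: p => //= [t s|t s|? -> ? ->|? -> ? ->|? -> ? ->|n p ->|n p ->];
  rewrite ?tpsub_FV.
Qed.

Section ParameterSubstitution.
Variables (L : discipline) (s : nat -> nat -> term).
Hypothesis typed_s : typed_psub L s.

Lemma tpsub_tsubst f t :
  tpsub s (tsubst f t) = tsubst (tpsub s \o f) (tpsub s t).
Proof.
elim: t => //= [n i|t -> //].
by rewrite (tsubst_closed _ (proj1 (typed_s n i))).
Qed.

Lemma up_tpsub f : tpsub s \o up f = up (tpsub s \o f).
Proof. by apply/funext; case=> //= k; rewrite /shift tpsub_tsubst. Qed.

Lemma psub_subst p f : psub s (subst f p) = subst (tpsub s \o f) (psub s p).
Proof.
by elim: p f => //= [t u|t u|p IHp q IHq|p IHp q IHq|p IHp q IHq|n p IHp|n p IHp] f;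
  rewrite ?tpsub_tsubst ?IHp ?IHq ?up_tpsub.
Qed.

Lemma psub_inst a p : psub s (inst a p) = inst (tpsub s a) (psub s p).
Proof. by rewrite /inst psub_subst; congr subst; apply/funext; case. Qed.

Lemma wft_tpsub G t : wft L G t ->
  wft L G (tpsub s t) /\ ty G (tpsub s t) = ty G t.
Proof.
elim: t => //= [n i _|t IH /andP[-> /IH[-> ->]] //].
by have [w e] := typed_s n i; have [] := wft_closed G w; rewrite e.
Qed.

Lemma wf_psub G p : wf L G p -> wf L G (psub s p).
Proof.
elim: p G => //= [t u|t u|p IHp q IHq|p IHp q IHq|p IHp q IHq|n p IHp|n p IHp] G.
1,2: by case/and3P=> /wft_tpsub[-> ->] /wft_tpsub[-> ->].
1,2,3: by case/andP=> /IHp-> /IHq->.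
1,2: exact: IHp.
Qed.

End ParameterSubstitution.

Definition pupd (A : Type) (s : nat -> nat -> A) (n i : nat) (a : A)
    (m j : nat) : A :=
  if (m, j) == (n, i) then a else s m j.

Lemma pupd_same (A : Type) (s : nat -> nat -> A) n i a : pupd s n i a n i = a.
Proof. by rewrite /pupd eqxx. Qed.

Lemma tpsub_pupd s n i a t : (n, i) \notin tfv t ->
  tpsub (pupd s n i a) t = tpsub s t.
Proof.
elim: t => //= [m j|t IH /IH -> //].
by rewrite mem_seq1 /pupd eq_sym => /negPf->.
Qed.

Lemma psub_pupd s n i a p : (n, i) \notin fv p ->
  psub (pupd s n i a) p = psub s p.
Proof.
elim: p => //= [t u|t u|p IHp q IHq|p IHp q IHq|p IHp q IHq|n' p IHp|n' p IHp].
1,2: by rewrite mem_cat negb_or => /andP[? ?]; rewrite !tpsub_pupd.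
1,2,3: by rewrite mem_cat negb_or => /andP[/IHp-> /IHq->].
1,2: by move=> /IHp->.
Qed.

Lemma typed_pupd L s n i a : typed_psub L s -> wft L [::] a ->
  ty [::] a = n -> typed_psub L (pupd s n i a).
Proof. by move=> hs wa ea m j; rewrite /pupd; case: eqP => // -[-> _]. Qed.

Lemma fresh (n : nat) (X : seq (nat * nat)) : exists i, (n, i) \notin X.
Proof.
exists (\max_(x <- X) x.2).+1; apply/negP => inX.
have le x : x \in X -> x.2 <= \max_(x <- X) x.2.
  by move=> xX; apply: leq_bigmax_seq.
by have := le _ inX; rewrite ltnn.
Qed.

Lemma fvs_notin n i D p : (n, i) \notin fvs D -> p \in D -> (n, i) \notin fv p.
Proof.
move=> nD pD; apply: contra nD => inp.
by apply/flattenP; exists (fv p) => //; apply: map_f.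
Qed.

(** * Structural rules *)

Section Structural.
Variables (L : discipline) (Ax : form -> Prop).

Lemma ded_wf D p : ded L Ax D p -> wf L [::] p.
Proof.
elim=> //= {D p}.
- by move=> D p q -> _ ->.
- by move=> D p q _ /andP[].
- by move=> D p q _ -> _ ->.
- by move=> D p q _ /andP[].
- by move=> D p q _ /andP[].
- by move=> D p q -> _ ->.
- by move=> D p q -> _ ->.
- by move=> D a ->; rewrite eqxx.
Qed.

Hypothesis Ax_psub : forall s p, typed_psub L s -> Ax p -> Ax (psub s p).

(** Substitution and weakening are proved in one induction. At [AllI] and [ExE] the eigenvariable is
    renamed to one fresh for the target context [D'], by updating [s] at [(n, i)]. The side
    conditions of the rule make this update invisible to the other formulas. *)
Lemma ded_psub D p s D' : ded L Ax D p -> typed_psub L s ->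
  {in D, forall q, psub s q \in D'} -> ded L Ax D' (psub s p).
Proof.
move=> d; elim: d s D' => {D p}.
- by move=> D p pD wp s D' hs hD; apply: Hyp; [exact: hD | exact: wf_psub].
- by move=> D p ax wp s D' hs hD; apply: Axm; [exact: Ax_psub | exact: wf_psub].
- move=> D p q wp _ IH s D' hs hD; apply: ImpI; first exact: wf_psub.
  apply: IH => // r; rewrite !inE => /predU1P[->|/hD ->]; by rewrite ?eqxx ?orbT.
- by move=> D p q _ IH1 _ IH2 s D' hs hD; apply: ImpE (IH1 _ _ hs hD) (IH2 _ _ hs hD).
- by move=> D p q _ IH1 _ IH2 s D' hs hD; apply: AndI (IH1 _ _ hs hD) (IH2 _ _ hs hD).
- by move=> D p q _ IH s D' hs hD; apply: AndE1 (IH _ _ hs hD).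
- by move=> D p q _ IH s D' hs hD; apply: AndE2 (IH _ _ hs hD).
- by move=> D p q wq _ IH s D' hs hD; apply: OrI1 (IH _ _ hs hD); exact: wf_psub.
- by move=> D p q wq _ IH s D' hs hD; apply: OrI2 (IH _ _ hs hD); exact: wf_psub.
- move=> D p q r _ IH1 _ IH2 _ IH3 s D' hs hD.
  by apply: OrE (IH1 _ _ hs hD) _ _; [apply: IH2|apply: IH3] => // u;
    rewrite !inE => /predU1P[->|/hD ->]; rewrite ?eqxx ?orbT.
- move=> D p wp _ IH s D' hs hD; apply: RAA; first exact: wf_psub.
  apply: (IH _ _ hs) => u.
  by rewrite !inE => /predU1P[->|/hD ->]; rewrite ?eqxx ?orbT.
- move=> D m n i p ok nD np wp _ IH s D' hs hD /=.
  have [j] := fresh n (fvs D' ++ fv (psub s p)); rewrite mem_cat negb_or.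
  case/andP=> nD' np'.
  apply: (AllI ok nD' np'); first exact: (wf_psub hs wp).
  have hs' : typed_psub L (pupd s n i (FV n j)) by apply: typed_pupd.
  have -> : inst (FV n j) (psub s p) = psub (pupd s n i (FV n j)) (inst (FV n i) p).
    by rewrite (psub_inst hs') /= (psub_pupd _ _ np) pupd_same.
  apply: IH => // q qD.
  by rewrite psub_pupd ?hD // (fvs_notin nD).
- move=> D n p a ok wa wp _ IH s D' hs hD.
  have [wa' ea] := wft_tpsub hs wa.
  have := wf_psub hs wp; rewrite (psub_inst hs) => wp'.
  by apply: AllE (IH _ _ hs hD) => //; rewrite ea.
- move=> D n p a ok wa wp _ IH s D' hs hD.
  have [wa' ea] := wft_tpsub hs wa.
  have := IH _ _ hs hD; rewrite (psub_inst hs) => d'.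
  by apply: ExI d' => //; [rewrite ea | exact: (wf_psub hs wp)].
- move=> D m n i p q ok nD np nq wp _ IH1 _ IH2 s D' hs hD /=.
  have [j] := fresh n (fvs D' ++ fv (psub s p) ++ fv (psub s q)).
  rewrite !mem_cat !negb_or; case/and3P=> nD' np' nq'.
  have hs' : typed_psub L (pupd s n i (FV n j)) by apply: typed_pupd.
  have e : inst (FV n j) (psub s p) = psub (pupd s n i (FV n j)) (inst (FV n i) p).
    by rewrite (psub_inst hs') /= (psub_pupd _ _ np) pupd_same.
  apply: (ExE ok nD' np' nq' _ (IH1 _ _ hs hD)); rewrite e; first exact: wf_psub.
  rewrite -(psub_pupd s (FV n j) nq); apply: IH2 => // r.
  rewrite !inE => /predU1P[->|rD]; first by rewrite eqxx.
  by rewrite psub_pupd ?hD ?orbT // (fvs_notin nD).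
- by move=> D a wa s D' hs hD; apply: EqI; case: (wft_tpsub hs wa).
- move=> D p a b wp _ IH1 _ IH2 s D' hs hD.
  have := IH2 _ _ hs hD; have := wf_psub hs wp.
  by rewrite !(psub_inst hs) => w' d'; apply: EqE w' (IH1 _ _ hs hD) d'.
Qed.

(** The identity case of [ded_psub]; a direct induction would be blocked by eigenvariables that
    occur in [D']. *)
Lemma weakening D D' p : {subset D <= D'} -> ded L Ax D p -> ded L Ax D' p.
Proof.
move=> sub d; rewrite -(psub_FV p); apply: ded_psub d _ _ => // q /sub.
by rewrite psub_FV.
Qed.

Lemma cut D D' p : {in D, forall q, ded L Ax D' q} -> ded L Ax D p ->
  ded L Ax D' p.
Proof.
elim: D p => [|q D IH] p hD d; first exact: weakening d.
have dq : ded L Ax D' q by apply: hD; rewrite mem_head.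
apply: (ImpE _ dq); apply: IH => [r rD|]; first by apply: hD; rewrite inE rD orbT.
by apply: ImpI => //; apply: ded_wf dq.
Qed.

End Structural.

(** * Many-sorted structures *)

(** One carrier sorted by [typ], instead of a family of domains, keeps assignments and environments
    free of dependent types. Sorting is imposed by the quantifier clauses of [holds] and by
    [typed_params] and [typed_env]. *)
Record structure : Type := Structure {
  dom :> Type;
  typ : dom -> nat;
  upS : dom -> dom;
  pos : dom -> dom -> Prop }.

Section Semantics.
Variable M : structure.
Implicit Types (v : nat -> nat -> M) (e : nat -> M) (G : seq nat).

Fixpoint tval v e (t : term) : M :=
  match t with
  | BV k => e k
  | FV n i => v n i
  | Up s => upS (tval v e s)
  end.

Fixpoint holds v e (p : form) : Prop :=
  match p with
  | Bot => False
  | Pred t s => pos (tval v e t) (tval v e s)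
  | Eq t s => tval v e t = tval v e s
  | Imp p q => holds v e p -> holds v e q
  | And p q => holds v e p /\ holds v e q
  | Or p q => holds v e p \/ holds v e q
  | All n p => forall d : M, typ d = n -> holds v (scons d e) p
  | Ex n p => exists2 d : M, typ d = n & holds v (scons d e) p
  end.

Definition typed_params v := forall n i, typ (v n i) = n.
Definition typed_env G e := forall k, k < size G -> typ (e k) = nth 0 G k.
Definition up_typed (L : discipline) :=
  up_ok L -> forall d : M, typ (upS d) = (typ d).+1.
Definition inhabited_types := forall n, exists d : M, typ d = n.

Lemma tval_tsubst v e f t :
  tval v e (tsubst f t) = tval v (fun k => tval v e (f k)) t.
Proof. by elim: t => //= t ->. Qed.

Lemma tval_shift v e d t : tval v (scons d e) (shift t) = tval v e t.
Proof. exact: tval_tsubst. Qed.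

Lemma holds_subst v e f p :
  holds v e (subst f p) = holds v (fun k => tval v e (f k)) p.
Proof.
have eup d g : (fun k => tval v (scons d g) (up f k)) =
               scons d (fun k => tval v g (f k)).
  by apply/funext; case=> //= k; rewrite tval_shift.
elim: p e f eup => //= [t s|t s|p IHp q IHq|p IHp q IHq|p IHp q IHq|n p IHp|n p IHp] e f eup;
  rewrite ?tval_tsubst ?IHp ?IHq //.
- apply: eq_forall => d; rewrite IHp ?eup // => d' g.
  by apply/funext; case=> //= k; rewrite tval_shift.
- congr (exists2 d, _ & _); apply/funext => d; rewrite IHp ?eup // => d' g.
  by apply/funext; case=> //= k; rewrite tval_shift.
Qed.

Lemma holds_inst v e a p : holds v e (inst a p) = holds v (scons (tval v e a) e) p.
Proof. by rewrite holds_subst; congr holds; apply/funext; case. Qed.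

Lemma holds_lift1 v e a b p :
  holds v (scons a (scons b e)) (lift1 p) = holds v (scons a e) p.
Proof. by rewrite holds_subst; congr holds; apply/funext; case. Qed.

Lemma typed_scons G e d n : typ d = n -> typed_env G e ->
  typed_env (n :: G) (scons d e).
Proof. by move=> ed he [|k] //= /he. Qed.

Lemma typed_env1 e d n : typ d = n -> typed_env [:: n] (scons d e).
Proof. by move=> td; case. Qed.

Lemma typ_tval L v e G t : up_typed L -> typed_params v -> typed_env G e ->
  wft L G t -> typ (tval v e t) = ty G t.
Proof.
by move=> hu hv he; elim: t => //= t IH /andP[ok /IH <-]; apply: hu.
Qed.

Lemma tval_pupd v e n i d t : (n, i) \notin tfv t ->
  tval (pupd v n i d) e t = tval v e t.
Proof.
elim: t => //= [m j|t IH /IH -> //].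
by rewrite mem_seq1 /pupd eq_sym => /negPf->.
Qed.

Lemma holds_pupd v e n i d p : (n, i) \notin fv p ->
  holds (pupd v n i d) e p = holds v e p.
Proof.
elim: p e => //= [t u|t u|p IHp q IHq|p IHp q IHq|p IHp q IHq|n' p IHp|n' p IHp] e.
1,2: by rewrite mem_cat negb_or => /andP[? ?]; rewrite !tval_pupd.
1,2,3: by rewrite mem_cat negb_or => /andP[/IHp-> /IHq->].
- by move=> np; apply: eq_forall => c; rewrite IHp.
- by move=> np; congr (exists2 d, _ & _); apply/funext => c; rewrite IHp.
Qed.

Lemma typed_params_pupd v n i d : typed_params v -> typ d = n ->
  typed_params (pupd v n i d).
Proof. by move=> hv ed m j; rewrite /pupd; case: eqP => // -[-> _]. Qed.

Lemma exists_typed_params : inhabited_types -> exists v, typed_params v.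
Proof.
by move=> inh; exists (fun n _ => projT1 (cid (inh n))) => n i; case: cid.
Qed.

(* For the quantifier rules to be sound, [b] need only agree with [a] on the
   formulas that are well-formed at both types. *)
Definition coherent (L : discipline) := forall m n (a : M),
  inst_ok L m n -> typ a = m ->
  exists2 b : M, typ b = n & forall v e p, typed_params v ->
    wf L [:: m] p -> wf L [:: n] p ->
    holds v (scons b e) p = holds v (scons a e) p.

Definition validates (Ax : form -> Prop) :=
  forall v e p, typed_params v -> Ax p -> holds v e p.

(** Only the quantifier rules need more than the usual argument. In each of them [coherent] trades
    an element of one type for an element of the other that satisfies the same φ. For [AllI] and
    [ExE] the new element becomes the value of the eigenvariable, and for [AllE] and [ExI] it
    replaces the value of the instantiating term. *)
Lemma soundness L Ax D p v e : up_typed L -> coherent L -> validates Ax ->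
  ded L Ax D p -> typed_params v -> (forall q, q \in D -> holds v e q) ->
  holds v e p.
Proof.
move=> hu coh val d; elim: d v => {D p}.
- by move=> D p pD _ v hv; apply.
- by move=> D p ax _ v hv _; apply: val.
- move=> D p q _ _ IH v hv hD /= hp; apply: IH => // r.
  by rewrite inE => /predU1P[->|/hD].
- by move=> D p q _ IH1 _ IH2 v hv hD; apply: (IH1 _ hv hD); apply: IH2.
- by move=> D p q _ IH1 _ IH2 v hv hD; split; [apply: IH1|apply: IH2].
- by move=> D p q _ IH v hv hD; case: (IH _ hv hD).
- by move=> D p q _ IH v hv hD; case: (IH _ hv hD).
- by move=> D p q _ _ IH v hv hD; left; apply: IH.
- by move=> D p q _ _ IH v hv hD; right; apply: IH.
- move=> D p q r _ IH1 _ IH2 _ IH3 v hv hD.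
  by case: (IH1 _ hv hD) => h; [apply: IH2|apply: IH3] => // u;
    rewrite inE => /predU1P[->|/hD].
- move=> D p _ _ IH v hv hD; apply: contrapT => np; apply: (IH _ hv) => q.
  by rewrite inE => /predU1P[->|/hD].
- move=> D m n i p ok nD np wp dp IH v hv hD /= a ta.
  have [b tb <- //] := coh _ _ _ ok ta; last first.
    by have := ded_wf dp; rewrite wf_inst.
  rewrite -(holds_pupd v _ b np).
  have := IH _ (typed_params_pupd i hv tb); rewrite holds_inst /= pupd_same.
  by apply=> q qD; rewrite holds_pupd; [exact: hD | exact: fvs_notin qD].
- move=> D n p a ok wa wp dp IH v hv hD; rewrite holds_inst.
  have he : typed_env [::] e by [].
  have [b tb <- //] := coh _ _ _ ok (typ_tval hu hv he wa); last first.
  + by have := ded_wf dp.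
  + by rewrite -wf_inst.
  exact: IH.
- move=> D n p a ok wa wp dp IH v hv hD.
  have he : typed_env [::] e by [].
  have [b tb eb] := coh _ _ _ ok (typ_tval hu hv he wa).
  exists b => //; rewrite eb -?holds_inst //; first exact: IH.
  by rewrite -wf_inst //; apply: ded_wf dp.
- move=> D m n i p q ok nD np nq wp d1 IH1 d2 IH2 v hv hD.
  have [a ta ha] := IH1 _ hv hD.
  have [b tb eb] := coh _ _ _ ok ta.
  have hv' := typed_params_pupd i hv tb.
  rewrite -(holds_pupd v e b nq); apply: IH2 => // r.
  rewrite inE => /predU1P[->|rD]; last first.
    by rewrite holds_pupd; [exact: hD | exact: fvs_notin rD].
  rewrite holds_inst /= pupd_same holds_pupd // eb //.
  + exact: (ded_wf d1).
  + by rewrite wf_inst in wp.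
- by [].
- move=> D p a b _ _ IH1 _ IH2 v hv hD.
  by have := IH2 _ hv hD; rewrite !holds_inst (IH1 _ hv hD).
Qed.

End Semantics.

(** * Completeness *)

Fixpoint tcode (t : term) : nat :=
  match t with
  | BV k => pickle (0, k, 0)
  | FV n i => pickle (1, n, i)
  | Up s => pickle (2, tcode s, 0)
  end.

Fixpoint fcode (p : form) : nat :=
  match p with
  | Bot => pickle (0, 0, 0)
  | Pred t s => pickle (1, tcode t, tcode s)
  | Eq t s => pickle (2, tcode t, tcode s)
  | Imp p q => pickle (3, fcode p, fcode q)
  | And p q => pickle (4, fcode p, fcode q)
  | Or p q => pickle (5, fcode p, fcode q)
  | All n p => pickle (6, n, fcode p)
  | Ex n p => pickle (7, n, fcode p)
  end.

Lemma tcode_inj : injective tcode.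
Proof.
by elim=> [k|n i|t IH] [k'|n' i'|t'] /= /(pcan_inj pickleK) // [];
  [move=> ->|move=> -> ->|move=> /IH ->].
Qed.

Lemma fcode_inj : injective fcode.
Proof.
elim=> [|t s|t s|p IHp q IHq|p IHp q IHq|p IHp q IHq|n p IHp|n p IHp]
  [|t' s'|t' s'|p' q'|p' q'|p' q'|n' p'|n' p'] /= /(pcan_inj pickleK) // [].
1,2: by move=> /tcode_inj-> /tcode_inj->.
1,2,3: by move=> /IHp-> /IHq->.
1,2: by move=> -> /IHp->.
Qed.

Lemma form_enumeration : exists en : nat -> form, forall p, exists k, en k = p.
Proof.
exists (fun k => if pselect (exists p, fcode p = k) is left h
                 then projT1 (cid h) else Bot) => p.
exists (fcode p); case: pselect => [h|[]]; last by exists p.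
by case: cid => q /= /fcode_inj.
Qed.

Lemma subset_consr (T : eqType) (x : T) (s : seq T) : {subset s <= x :: s}.
Proof. by move=> y ys; rewrite inE ys orbT. Qed.

(** * Henkin's maximal consistent extension *)

Section Henkin.
Variables (L : discipline) (Ax : form -> Prop).
Hypothesis inst_refl : forall n, inst_ok L n n.
Hypothesis Ax_psub : forall s p, typed_psub L s -> Ax p -> Ax (psub s p).

Notation ded := (ded L Ax).
Definition consistent D := ~ ded D Bot.

Variable en : nat -> form.
Hypothesis en_surj : forall p, exists k, en k = p.
Variable D0 : seq form.
Hypothesis con0 : consistent D0.

Definition witnessed (D : seq form) (p : form) : seq form :=
  if p is Ex n q
  then inst (FV n (projT1 (cid (fresh n (fvs (p :: D)))))) q :: p :: D
  else p :: D.

Definition extend (D : seq form) (p : form) : seq form :=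
  if pselect (wf L [::] p /\ consistent (p :: D)) then witnessed D p else D.

Fixpoint stage (k : nat) : seq form :=
  if k is j.+1 then extend (stage j) (en j) else D0.

Lemma witnessed_sub D p : {subset p :: D <= witnessed D p}.
Proof. by move=> q; case: p => // n p qD; apply: subset_consr. Qed.

Lemma extend_sub D p : {subset D <= extend D p}.
Proof.
rewrite /extend; case: pselect => [? q qD|? q qD] //=.
by apply: witnessed_sub; apply: subset_consr.
Qed.

(** The fresh witness is a legitimate eigenvariable: by [ExE] with conclusion [Bot], a contradiction
    derived with it is already derivable from the existential formula without it. *)
Lemma stage_consistent k : consistent (stage k).
Proof.
elim: k => //= k IH; rewrite /extend; case: pselect => // -[wp con] /=.
case: (en k) wp con => //= n p wp con; case: cid => i /=.
rewrite /fvs /= mem_cat negb_or => /andP[np nD] d; apply: con.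
apply: (ExE (inst_refl n) _ np _ _ _ d) => //.
- by rewrite /fvs /= mem_cat negb_or np.
- by rewrite wf_inst.
- by apply: Hyp; rewrite ?mem_head.
Qed.

Lemma stage_mono j k : j <= k -> {subset stage j <= stage k}.
Proof.
move=> /subnK <-; elim: (k - j) => //= i IH p /IH; exact: extend_sub.
Qed.

Definition Th p := exists k, ded (stage k) p.

Lemma Th_wf p : Th p -> wf L [::] p.
Proof. by case=> k /ded_wf. Qed.

(** A derivation has finitely many assumptions, and the stages increase, so a single stage proves
    them all. *)
Lemma Th_ded D p : {in D, forall q, Th q} -> ded D p -> Th p.
Proof.
move=> hD d; suff [k hk] : exists k, {in D, forall q, ded (stage k) q}.
  by exists k; apply: cut d.
elim: D hD {d} => [|q D IH] hD; first by exists 0.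
have [k1 h1] : Th q by apply: hD; rewrite mem_head.
have [r rD|k2 h2] := IH; first by apply: hD; rewrite inE rD orbT.
exists (maxn k1 k2) => r; rewrite inE => /predU1P[->|/h2 h3].
  by apply: (weakening Ax_psub _ h1); apply: stage_mono; rewrite leq_maxl.
by apply: (weakening Ax_psub _ h3); apply: stage_mono; rewrite leq_maxr.
Qed.

Lemma Th_thm p : ded [::] p -> Th p.
Proof. exact: Th_ded. Qed.

Lemma Th_consistent : ~ Th Bot.
Proof. by case=> k /stage_consistent. Qed.

Lemma Th_maximal p : wf L [::] p -> Th p \/ Th (Not p).
Proof.
move=> wp; have [k ek] := en_surj p.
case: (pselect (consistent (p :: stage k))) => [con|/contrapT d]; last first.
  by right; exists k; apply: ImpI.
left; exists k.+1; apply: Hyp => //=; rewrite /extend ek.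
case: pselect => [_|[]//] /=; apply: witnessed_sub; exact: mem_head.
Qed.

Lemma Th_witness n p : Th (Ex n p) -> exists i, Th (inst (FV n i) p).
Proof.
move=> TE; have wp := Th_wf TE; have [k ek] := en_surj (Ex n p).
(* When the enumeration reaches [Ex n p], this formula is consistent with the current stage, since
   otherwise [Th] would contain its negation as well. So it was added then, along with its
   witness. *)
case: (pselect (consistent (Ex n p :: stage k))) => [con|/contrapT d]; last first.
  case: Th_consistent; apply: (@Th_ded [:: Ex n p; Not (Ex n p)]).
    move=> q; rewrite !inE => /pred2P[]-> //.
    by exists k; apply: ImpI.
  by apply: (@ImpE _ _ _ (Ex n p)); apply: Hyp; rewrite ?inE ?eqxx ?orbT //= ?andbT.
exists (projT1 (cid (fresh n (fvs (Ex n p :: stage k))))), k.+1 => /=.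
apply: Hyp; last by rewrite wf_inst.
by rewrite /extend ek; case: pselect => [?|[]//]; rewrite mem_head.
Qed.

Lemma Th_ImpE p q : Th (Imp p q) -> Th p -> Th q.
Proof.
move=> h1 h2; apply: (@Th_ded [:: Imp p q; p]) => [r|].
  by rewrite !inE => /pred2P[]->.
by apply: (@ImpE _ _ _ p); apply: Hyp; rewrite ?inE ?eqxx ?orbT // Th_wf.
Qed.

Lemma Th_Not p : Th (Not p) -> ~ Th p.
Proof. by move=> /Th_ImpE h /h /Th_consistent. Qed.

(** This and the next four lemmas show that membership in [Th] obeys the truth clauses of the
    connectives and quantifiers, as the truth lemma requires. *)
Lemma Th_Imp p q : wf L [::] p -> wf L [::] q ->
  (Th p -> Th q) <-> Th (Imp p q).
Proof.
move=> wp wq; split=> [h|/Th_ImpE //]; have [/h Tq|Tnp] := Th_maximal wp.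
- apply: (@Th_ded [:: q]) => [r|]; first by rewrite inE => /eqP->.
  by apply: ImpI => //; apply: Hyp; rewrite ?inE ?eqxx ?orbT.
- apply: (@Th_ded [:: Not p]) => [r|]; first by rewrite inE => /eqP->.
  apply: ImpI => //; apply: RAA => //.
  by apply: (@ImpE _ _ _ p); apply: Hyp; rewrite ?inE ?eqxx ?orbT //= ?wp.
Qed.

Lemma Th_And p q : (Th p /\ Th q) <-> Th (And p q).
Proof.
split=> [[hp hq]|h].
  apply: (@Th_ded [:: p; q]) => [r|]; first by rewrite !inE => /pred2P[]->.
  by apply: AndI; apply: Hyp; rewrite ?inE ?eqxx ?orbT // Th_wf.
have d : ded [:: And p q] (And p q) by apply: Hyp; rewrite ?mem_head ?Th_wf.
have hT : {in [:: And p q], forall r, Th r} by move=> r; rewrite inE => /eqP->.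
by split; apply: Th_ded hT _; [apply: AndE1 d|apply: AndE2 d].
Qed.

Lemma Th_Or p q : wf L [::] p -> wf L [::] q ->
  (Th p \/ Th q) <-> Th (Or p q).
Proof.
move=> wp wq; split=> [[h|h]|h].
- apply: (@Th_ded [:: p]) => [r|]; first by rewrite inE => /eqP->.
  by apply: OrI1 => //; apply: Hyp; rewrite ?mem_head.
- apply: (@Th_ded [:: q]) => [r|]; first by rewrite inE => /eqP->.
  by apply: OrI2 => //; apply: Hyp; rewrite ?mem_head.
have [|hp] := Th_maximal wp; first by left.
right; apply: (@Th_ded [:: Or p q; Not p]) => [r|].
  by rewrite !inE => /pred2P[]->.
apply: (@OrE _ _ _ p q); [| |]; try by apply: Hyp; rewrite ?inE ?eqxx ?orbT //= ?wp.
apply: RAA => //.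
by apply: (@ImpE _ _ _ p); apply: Hyp; rewrite ?inE ?eqxx ?orbT //= ?wp.
Qed.

Lemma Th_Ex n p : wf L [:: n] p ->
  (exists t, [/\ wft L [::] t, ty [::] t = n & Th (inst t p)]) <-> Th (Ex n p).
Proof.
move=> wp; split=> [[t [wt et h]]|/Th_witness[i h]]; last by exists (FV n i).
apply: (@Th_ded [:: inst t p]) => [r|]; first by rewrite inE => /eqP->.
apply: (@ExI _ _ _ n p t) => //; first by rewrite et.
by apply: Hyp; rewrite ?mem_head // Th_wf.
Qed.

Lemma Th_All n p : wf L [:: n] p ->
  (forall t, wft L [::] t -> ty [::] t = n -> Th (inst t p)) <-> Th (All n p).
Proof.
move=> wp; split=> [h|h t wt et]; last first.
  apply: (@Th_ded [:: All n p]) => [r|]; first by rewrite inE => /eqP->.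
  apply: (@AllE _ _ _ n) => //; rewrite ?et ?wf_inst ?et //.
  by apply: Hyp; rewrite ?mem_head.
(* By maximality [Th] decides ∃x¬φ. If it holds, its witness contradicts the hypothesis on
   instances; if it is refuted, ∀xφ follows by classical logic with a fresh parameter. *)
have wE : wf L [::] (Ex n (Not p)) by rewrite /= wp.
case: (Th_maximal wE) => [/Th_witness[i]|hN].
  by move=> /Th_Not[]; apply: h.
apply: (@Th_ded [:: Not (Ex n (Not p))]) => [r|]; first by rewrite inE => /eqP->.
have [i ni] := fresh n (fv p).
have wi : wf L [::] (inst (FV n i) p) by rewrite wf_inst.
apply: (@AllI _ _ _ n n i) => //; first by rewrite /fvs /= !cats0.
apply: RAA => //; apply: (@ImpE _ _ _ (Ex n (Not p))).
  by apply: Hyp; rewrite ?inE ?eqxx ?orbT //= wp.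
apply: (@ExI _ _ _ n (Not p) (FV n i)) => //.
by apply: Hyp; rewrite ?mem_head //= andbT.
Qed.

Lemma Th_subst p a b : Th (Eq a b) -> wf L [::] (inst b p) -> Th (inst a p) ->
  Th (inst b p).
Proof.
move=> h1 wb h2; apply: (@Th_ded [:: Eq a b; inst a p]) => [r|].
  by rewrite !inE => /pred2P[]->.
by apply: (@EqE _ _ _ p a b) => //; apply: Hyp;
  rewrite ?inE ?eqxx ?orbT //; apply: Th_wf.
Qed.

Lemma Th_refl a : wft L [::] a -> Th (Eq a a).
Proof. by move=> wa; apply: Th_thm; apply: EqI. Qed.

Lemma Th_wfl a b : Th (Eq a b) -> wft L [::] a.
Proof. by move=> /Th_wf /= /and3P[]. Qed.

Lemma Th_wfr a b : Th (Eq a b) -> wft L [::] b.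
Proof. by move=> /Th_wf /= /and3P[]. Qed.

Lemma Th_ty a b : Th (Eq a b) -> ty [::] a = ty [::] b.
Proof. by move=> /Th_wf /= /and3P[_ _ /eqP]. Qed.

Lemma Th_sym a b : Th (Eq a b) -> Th (Eq b a).
Proof.
move=> h; have wa := Th_wfl h; have wb := Th_wfr h; have e := Th_ty h.
have := @Th_subst (Eq (BV 0) a) a b h.
rewrite /inst /= !(tsubst_closed _ wa) wa wb e eqxx => /(_ isT); apply.
exact: Th_refl.
Qed.

Lemma Th_trans a b c : Th (Eq a b) -> Th (Eq b c) -> Th (Eq a c).
Proof.
move=> h1 h2; have wa := Th_wfl h1; have wc := Th_wfr h2.
have := @Th_subst (Eq a (BV 0)) b c h2.
rewrite /inst /= !(tsubst_closed _ wa) wa wc -(Th_ty h2) (Th_ty h1) eqxx => /(_ isT h1); apply.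
Qed.

Lemma Th_Up a b : up_ok L -> Th (Eq a b) -> Th (Eq (Up a) (Up b)).
Proof.
move=> ok h; have wa := Th_wfl h; have wb := Th_wfr h; have e := Th_ty h.
have := @Th_subst (Eq (Up a) (Up (BV 0))) a b h.
rewrite /inst /= !(tsubst_closed _ wa) wa wb e eqxx ok => /(_ isT); apply.
by apply: Th_refl; rewrite /= ok.
Qed.

Lemma Th_Pred a b c d : Th (Eq a b) -> Th (Eq c d) ->
  Th (Pred a c) -> Th (Pred b d).
Proof.
move=> h1 h2 h; have := Th_wf h => /= /and3P[wa wc pok].
have wb := Th_wfr h1; have wd := Th_wfr h2.
have := @Th_subst (Pred (BV 0) c) a b h1.
rewrite /inst /= !(tsubst_closed _ wc) wb wc -(Th_ty h1) pok => /(_ isT h) h'.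
have := @Th_subst (Pred b (BV 0)) c d h2.
rewrite /inst /= !(tsubst_closed _ wb) wb wd -(Th_ty h1) -(Th_ty h2) pok => /(_ isT h'); apply.
Qed.

(** * The term model *)

Definition pick_term (P : term -> Prop) : term :=
  if pselect (exists t, P t) is left h then projT1 (cid h) else FV 0 0.

(** The choice depends only on the class of [t] as a predicate, so by extensionality provably equal
    terms get literally the same representative. The quotient by provable equality is then the
    subtype of terms that represent themselves. *)
Definition rep t := pick_term (fun u => Th (Eq t u)).

Lemma rep_eq t : wft L [::] t -> Th (Eq t (rep t)).
Proof.
move=> wt; rewrite /rep /pick_term; case: pselect => [h|[]].
  by case: cid.
by exists t; apply: Th_refl.
Qed.

Lemma eq_rep a b : Th (Eq a b) -> rep a = rep b.
Proof.
move=> h; congr pick_term; apply/funext => u; apply/propext; split; apply: Th_trans => //.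
exact: Th_sym.
Qed.

Definition canonical t := wft L [::] t && (`[< rep t = t >]).
Definition cdom := {t : term | canonical t}.

Lemma canonical_rep t : wft L [::] t -> canonical (rep t).
Proof.
move=> /rep_eq h; rewrite /canonical (Th_wfr h); apply/asboolP.
by rewrite -(eq_rep h).
Qed.

(** Total on terms: when [rep t] is not canonical, as may happen for ill-formed [t], the value
    defaults to the class of [FV 0 0]. *)
Definition cls t : cdom :=
  insubd (exist _ (rep (FV 0 0)) (@canonical_rep (FV 0 0) isT)) (rep t).

Lemma val_cls t : wft L [::] t -> val (cls t) = rep t.
Proof. by move=> /canonical_rep h; rewrite val_insubd h. Qed.

Lemma wft_val (d : cdom) : wft L [::] (val d).
Proof. by case: d => t /= /andP[]. Qed.

Lemma cls_val d : cls (val d) = d.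
Proof.
apply: val_inj; rewrite val_cls ?wft_val //.
by case: d => t /= /andP[_ /asboolP].
Qed.

Lemma cls_eq a b : wft L [::] a -> wft L [::] b ->
  cls a = cls b <-> Th (Eq a b).
Proof.
move=> wa wb; split=> [/(congr1 val)|/eq_rep e].
  rewrite !val_cls // => e; apply: Th_trans (rep_eq wa) _; rewrite e.
  exact: Th_sym (rep_eq wb).
by rewrite /cls e.
Qed.

Definition term_model : structure :=
  @Structure cdom (fun d => ty [::] (val d)) (fun d => cls (Up (val d)))
    (fun d c => Th (Pred (val d) (val c))).

Definition generic_params (n i : nat) : term_model := cls (FV n i).

Lemma typ_cls t : wft L [::] t -> typ (cls t : term_model) = ty [::] t.
Proof. by move=> wt; rewrite /= val_cls // (Th_ty (rep_eq wt)). Qed.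

Lemma upS_cls t : up_ok L -> wft L [::] t ->
  upS (cls t : term_model) = cls (Up t).
Proof.
move=> ok wt; have h := rep_eq wt; have wr := Th_wfr h.
apply/cls_eq; rewrite /= ?val_cls // ?ok //.
by apply: Th_Up => //; apply: Th_sym.
Qed.

Lemma pos_cls t s : wft L [::] t -> wft L [::] s ->
  pos (cls t : term_model) (cls s) <-> Th (Pred t s).
Proof.
move=> wt ws; rewrite /= !val_cls //.
by split; apply: Th_Pred; rewrite ?rep_eq //; try exact: Th_sym (rep_eq _);
  exact: rep_eq.
Qed.

Lemma tval_generic e f G t : typed_subst L G [::] f ->
  (forall k, k < size G -> e k = cls (f k)) -> wft L G t ->
  tval generic_params e t = cls (tsubst f t).
Proof.
move=> hf he; elim: t => [k /he //|//|t IH /andP[ok wt]].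
change (upS (tval generic_params e t) = cls (Up (tsubst f t))).
rewrite (IH wt) upS_cls //; by have [-> _] := wft_tsubst t hf.
Qed.

(** Stated for open formulas with a closing substitution [f] matched by the environment [e], so that
    the induction passes under quantifiers. There every element of the model is the class of a
    closed term, by [cls_val]. *)
Lemma truth p e f G : typed_subst L G [::] f ->
  (forall k, k < size G -> e k = cls (f k)) -> wf L G p ->
  holds generic_params e p <-> Th (subst f p).
Proof.
elim: p e f G => [|t s|t s|p IHp q IHq|p IHp q IHq|p IHp q IHq|n p IHp|n p IHp]
  e f G hf he /= wp.
- by split=> // /Th_consistent.
- have /and3P[wt ws _] := wp.
  rewrite !(tval_generic hf he) //; apply: pos_cls.
  + by have [-> _] := wft_tsubst t hf.
  + by have [-> _] := wft_tsubst s hf.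
- have /and3P[wt ws _] := wp.
  rewrite !(tval_generic hf he) //; apply: cls_eq.
  + by have [-> _] := wft_tsubst t hf.
  + by have [-> _] := wft_tsubst s hf.
- have /andP[w1 w2] := wp; rewrite (IHp _ _ _ hf he w1) (IHq _ _ _ hf he w2).
  by apply: Th_Imp; rewrite (wf_subst _ hf).
- have /andP[w1 w2] := wp; rewrite (IHp _ _ _ hf he w1) (IHq _ _ _ hf he w2).
  exact: Th_And.
- have /andP[w1 w2] := wp; rewrite (IHp _ _ _ hf he w1) (IHq _ _ _ hf he w2).
  by apply: Th_Or; rewrite (wf_subst _ hf).
- have wp' : wf L [:: n] (subst (up f) p) by rewrite (wf_subst _ (typed_up n hf)).
  have IH t : wft L [::] t -> ty [::] t = n ->
      holds generic_params (scons (cls t) e) p <-> Th (inst t (subst (up f) p)).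
    move=> wt et; rewrite inst_subst_up; apply: IHp wp.
      by case=> [|k]; [rewrite /= wt et | apply: hf].
    by case=> [|k] //=; apply: he.
  rewrite -Th_All //; split=> [h t wt et|h d td].
    by apply/IH => //; apply: h; rewrite -et; apply: typ_cls.
  by rewrite -(cls_val d); apply/IH; rewrite ?wft_val //; apply: h; rewrite ?wft_val.
- have wp' : wf L [:: n] (subst (up f) p) by rewrite (wf_subst _ (typed_up n hf)).
  have IH t : wft L [::] t -> ty [::] t = n ->
      holds generic_params (scons (cls t) e) p <-> Th (inst t (subst (up f) p)).
    move=> wt et; rewrite inst_subst_up; apply: IHp wp.
      by case=> [|k]; [rewrite /= wt et | apply: hf].
    by case=> [|k] //=; apply: he.
  rewrite -Th_Ex //; split=> [[d td]|[t [wt et]] /(IH _ wt et) h].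
    rewrite -(cls_val d) => /IH h; exists (val d); split; rewrite ?wft_val //.
    by apply: h; rewrite ?wft_val.
  by exists (cls t) => //; rewrite -et; apply: typ_cls.
Qed.

Lemma truth_sentence p e : wf L [::] p -> holds generic_params e p <-> Th p.
Proof. by move=> wp; rewrite -{2}(subst_id p); apply: (@truth _ _ _ [::]). Qed.

Lemma tval_tpsub (v : nat -> nat -> term_model) e t :
  tval generic_params e (tpsub (fun n i => val (v n i)) t) = tval v e t.
Proof.
elim: t => //= [n i|t -> //].
rewrite (@tval_generic _ BV [::]) ?wft_val //.
by rewrite tsubst_id cls_val.
Qed.

Lemma holds_psub (v : nat -> nat -> term_model) e p :
  holds generic_params e (psub (fun n i => val (v n i)) p) = holds v e p.
Proof.
elim: p e => //= [t s|t s|p IHp q IHq|p IHp q IHq|p IHp q IHq|n p IHp|n p IHp] e;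
  rewrite ?tval_tpsub ?IHp ?IHq //.
- by apply: eq_forall => c; rewrite IHp.
- by congr (exists2 d, _ & _); apply/funext => c; rewrite IHp.
Qed.

(** Truth is required under every typed assignment, not only the generic one. Evaluating under [v]
    amounts to substituting representatives for the parameters, and theorems are closed under such
    substitutions. *)
Lemma term_model_thm v e p : typed_params v -> ded [::] p ->
  @holds term_model v e p.
Proof.
move=> hv d; rewrite -holds_psub.
have hs : typed_psub L (fun n i => val (v n i)).
  by move=> n i; split; [exact: wft_val | exact: hv].
have d' := ded_psub Ax_psub d hs (D' := [::]) (fun _ => id).
by apply/truth_sentence; [exact: ded_wf d' | exact: Th_thm].
Qed.

Lemma term_model_up : up_typed term_model L.
Proof.
move=> ok d; rewrite -{1}(cls_val d) upS_cls ?wft_val // typ_cls //=.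
by rewrite ok wft_val.
Qed.

Lemma term_model_inhabited : inhabited_types term_model.
Proof. by move=> n; exists (cls (FV n 0)); rewrite typ_cls. Qed.

Lemma generic_typed : typed_params generic_params.
Proof. by move=> n i; rewrite typ_cls. Qed.

End Henkin.

(** All theorems are required to hold, not merely the axioms: the cumulative quantifier rules are
    not axioms, and truth of the axioms in a structure does not make these rules sound there. Any
    derived formula can thus be evaluated in the model. *)
Definition models (M : structure) (T : theory) : Prop :=
  [/\ up_typed M (lang T), inhabited_types M &
    forall p (v : nat -> nat -> M) e, typed_params v -> thm T p -> holds v e p].

Theorem completeness (T : theory) (p : form) :
  (forall n, inst_ok (lang T) n n) ->
  (forall s q, typed_psub (lang T) s -> axioms T q -> axioms T (psub s q)) ->
  wf (lang T) [::] p ->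
  (forall (M : structure) (v : nat -> nat -> M) e, models M T ->
     typed_params v -> holds v e p) ->
  thm T p.
Proof.
move=> inst_refl Ax_psub wp h; apply: RAA => //; apply: contrapT => con.
have [en en_surj] := form_enumeration.
pose M := term_model Ax_psub en [:: Not p].
have inh : inhabited_types M by apply: term_model_inhabited.
have gen := generic_typed Ax_psub en [:: Not p].
have hM : models M T.
  split=> //; first exact: term_model_up.
  by move=> q v e hv d; apply: (term_model_thm inst_refl en_surj con).
have [d _] := inh 0.
have /(truth_sentence inst_refl en_surj con)-/(_ wp) :=
  h M _ (fun _ => d) hM gen.
apply: (Th_Not inst_refl Ax_psub con).
by exists 0; apply: Hyp; rewrite ?mem_head //= wp.
Qed.

(** * Translations *)

(** The carrier and its sorting are retained, so that assignments and environments pass between the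
    two structures unchanged. *)
Definition restructure (M : structure) (u : M -> M) (P : M -> M -> Prop) :
  structure := @Structure M (@typ M) u P.

Lemma holds_restructure_id (M : structure) (v : nat -> nat -> M) e p :
  @holds (restructure (@upS M) (@pos M)) v e p = holds v e p.
Proof. by case: M v e. Qed.

Section WellFormedTranslation.
Variables (L1 L2 : discipline) (I : translation).
Hypothesis wf_ipred : forall n m, pred_ok L1 n m -> wf L2 [:: m; n] (ipred I n m).
Hypothesis wf_iup : up_ok L1 -> forall n, wf L2 [:: n.+1; n] (iup I n).

Lemma wf_tr_at G t q : wft L1 G t -> wf L2 (ty G t :: G) q ->
  wf L2 G (tr_at I G t q).
Proof.
elim: t q => [k|n i|t IH] q /=; try by move=> w wq; rewrite wf_inst.
case/andP=> ok wt wq; apply: IH => //=; rewrite wf_lift1 wq andbT.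
exact: (wf_cat G (wf_iup ok (ty G t))).
Qed.

Lemma wf_tr G p : wf L1 G p -> wf L2 G (tr I G p).
Proof.
elim: p G => //= [t s|t s|p IHp q IHq|p IHp q IHq|p IHp q IHq|n p IHp|n p IHp] G.
- case/and3P=> wt ws ok; apply: wf_tr_at => //; apply: wf_tr_at.
    by rewrite wft_shift.
  by rewrite ty_shift; apply: (wf_cat G (wf_ipred ok)).
- case/and3P=> wt ws e; apply: wf_tr_at => //; apply: wf_tr_at.
    by rewrite wft_shift.
  by rewrite ty_shift /= eq_sym in e *.
1,2,3: by case/andP=> /IHp-> /IHq->.
1,2: exact: IHp.
Qed.

End WellFormedTranslation.

Section TranslationSemantics.
Variables (L1 : discipline) (I : translation) (M : structure).
Variables (u : M -> M) (P : M -> M -> Prop).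
Let N := restructure u P.
Hypothesis up_typed_N : up_typed N L1.
Hypothesis ipredP : forall n m (v : nat -> nat -> M) e d c, pred_ok L1 n m ->
  typed_params v -> typ d = n -> typ c = m ->
  holds v (scons c (scons d e)) (ipred I n m) = P d c.
Hypothesis iupP : up_ok L1 -> forall n (v : nat -> nat -> M) e x y,
  typed_params v -> typ x = n -> typ y = n.+1 ->
  holds v (scons y (scons x e)) (iup I n) = (y = u x).
Variable v : nat -> nat -> M.
Hypothesis typed_v : typed_params v.

(** By [iupP] the existential that replaces an occurrence of ↑ can only be witnessed by the value of
    [u], which [up_typed_N] places in the type over which the quantifier ranges. *)
Lemma holds_tr_at G (e : nat -> M) t q : wft L1 G t -> typed_env G e ->
  holds v e (tr_at I G t q) = holds v (scons (@tval N v e t) e) q.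
Proof.
move=> + he; elim: t q => [k|n i|t IH] q /=; rewrite ?holds_inst //.
case/andP=> ok wt; rewrite IH //=.
have ht : typ (@tval N v e t) = ty G t := typ_tval up_typed_N typed_v he wt.
have hu : typ (u (@tval N v e t)) = (ty G t).+1.
  by rewrite -ht; apply: (up_typed_N ok).
apply/propext; split=> [[d td []]|h].
  by rewrite (iupP ok) // holds_lift1 => ->.
by exists (u (@tval N v e t)) => //; rewrite (iupP ok) // holds_lift1.
Qed.

(** The bridge from syntax to model constructions: one instance for each interpretation, and one
    further instance for the outer structure in each round trip. *)
Lemma holds_tr G (e : nat -> M) p : wf L1 G p -> typed_env G e ->
  holds v e (tr I G p) = @holds N v e p.
Proof.
have tt G' (e' : nat -> M) t : wft L1 G' t -> typed_env G' e' ->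
    typ (@tval N v e' t) = ty G' t.
  by move=> wt he; apply: (typ_tval up_typed_N typed_v he wt).
have ts (e' : nat -> M) d t : @tval N v (scons d e') (shift t) = @tval N v e' t.
  exact: (@tval_shift N).
elim: p G e => //= [t s|t s|p IHp q IHq|p IHp q IHq|p IHp q IHq|n p IHp|n p IHp] G e.
- case/and3P=> wt ws ok he; rewrite holds_tr_at // holds_tr_at ?wft_shift //; last first.
    by apply: typed_scons => //; apply: tt.
  by rewrite ts ipredP //; apply: tt.
- case/and3P=> wt ws ok he; rewrite holds_tr_at // holds_tr_at ?wft_shift //; last first.
    by apply: typed_scons => //; apply: tt.
  by rewrite ts.
1,2,3: by case/andP=> w1 w2 he; rewrite (IHp _ _ w1 he) (IHq _ _ w2 he).
- move=> w he; apply: eq_forall => d; apply: eq_forall => td.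
  by rewrite (IHp _ _ w) //; apply: typed_scons.
- move=> w he; apply/propext; split=> -[d td h]; exists d => //;
    by move: h; rewrite (IHp _ _ w) //; apply: typed_scons.
Qed.

End TranslationSemantics.

(** * Indiscernibility and defined membership *)

Definition agree (M : structure) (k : nat) (x y : M) :=
  forall z, typ z = k -> (pos z x <-> pos z y).

Lemma agree_sym (M : structure) k (x y : M) : agree k x y -> agree k y x.
Proof. by move=> h z /h []. Qed.

Lemma agree_trans (M : structure) k (x y z : M) :
  agree k x y -> agree k y z -> agree k x z.
Proof. by move=> h1 h2 w tw; rewrite (h1 w tw); apply: h2. Qed.

Lemma holds_Equiv (M : structure) (v : nat -> nat -> M) e m n a b :
  holds v e (Equiv m n a b) <->
  agree (maxn m n).+1 (tval v e a) (tval v e b).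
Proof.
by split=> h z /h /=; rewrite !tval_shift // => -[].
Qed.

Lemma holds_HatIn (M : structure) (v : nat -> nat -> M) e m n a b :
  holds v e (HatIn m n a b) <->
  exists2 z, typ z = (maxn m n).+1 &
    agree (maxn m n).+2 z (tval v e b) /\ pos z (tval v e a).
Proof.
have ek : maxn (maxn m n).+1 n = (maxn m n).+1 by lia.
have eE z : holds v (scons z e) (Equiv (maxn m n).+1 n (BV 0) (shift b)) <->
    agree (maxn m n).+2 z (tval v e b).
  by rewrite holds_Equiv ek /= tval_shift.
by split=> -[z tz [h1 h2]]; exists z => //; move: h1 h2 => /eE ?; rewrite /= tval_shift.
Qed.

(** Formulas have no names for elements of a model, so parameters serve instead. The distinct
    indices 0 and 1 keep the two elements apart when their types coincide. *)
Lemma two_params (M : structure) (x y : M) : inhabited_types M ->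
  exists v, [/\ typed_params v, v (typ x) 0 = x & v (typ y) 1 = y].
Proof.
move=> /exists_typed_params[v hv].
exists (pupd (pupd v (typ x) 0 x) (typ y) 1 y); split.
- by do 2!apply: typed_params_pupd => //.
- by rewrite {1}/pupd xpair_eqE andbF pupd_same.
- by rewrite pupd_same.
Qed.

Lemma models_comprehension (M : structure) T (v : nat -> nat -> M) e n p :
  models M T -> pred_ok (lang T) n.+1 n -> axioms T (comprehension n p) ->
  wf (lang T) [:: n] p -> typed_params v ->
  exists2 z, typ z = n.+1 &
    forall x, typ x = n -> (pos z x <-> holds v (scons x (scons z e)) p).
Proof.
case=> _ _ thmM ok ax wp hv.
have d : thm T (comprehension n p).
  by apply: Axm => //=; rewrite ok (wf_cat [:: n.+1] wp).
by have [z tz h] := thmM _ v e hv d; exists z.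
Qed.

(** * Models of cumulative type theory *)

(** The form in which the cumulative quantifier rules are used inside models: instantiate at a
    parameter of the lower type, then generalise at that type. *)
Lemma cumulative_down n m p : m <= n -> wf cumulative [:: n] p ->
  wf cumulative [:: m] p -> thm CTTomega (Imp (All n p) (All m p)).
Proof.
move=> le_mn wn wm; apply: ImpI => //.
have [i ni] := fresh m (fv p).
have wi : wf cumulative [::] (inst (FV m i) p) by rewrite wf_inst.
apply: (@AllI _ _ _ m m i) => //=.
  by rewrite /fvs /= cats0.
by apply: (@AllE _ _ _ n) => //; apply: Hyp; rewrite ?mem_head.
Qed.

Section CumulativeModels.
Variable M : structure.
Hypothesis M_CTT : models M CTTomega.
Implicit Types x y z w d c : M.

Let inh : inhabited_types M. Proof. by case: M_CTT. Qed.

Lemma CTT_down (v : nat -> nat -> M) e n m p c : typed_params v -> m <= n ->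
  wf cumulative [:: n] p -> wf cumulative [:: m] p ->
  (forall d, typ d = n -> holds v (scons d e) p) ->
  typ c = m -> holds v (scons c e) p.
Proof.
case: M_CTT => _ _ thmM hv le wn wm h.
exact: (thmM _ v e hv (cumulative_down le wn wm) h).
Qed.

Lemma CTT_comprehension_model (v : nat -> nat -> M) e n p : typed_params v ->
  wf cumulative [:: n] p ->
  exists2 z, typ z = n.+1 &
    forall x, typ x = n -> (pos z x <-> holds v (scons x (scons z e)) p).
Proof.
move=> hv wp; apply: (models_comprehension e M_CTT) => //=.
exact: CTT_comprehension.
Qed.

(** Comprehension supplies the singleton of [x], one type up; it contains [x], hence also [y]. *)
Lemma agree_eq x y : typ x = typ y -> agree (typ x).+1 x y -> x = y.
Proof.
move=> exy h; have [v [hv vx _]] := two_params x x inh.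
have [z tz hz] := @CTT_comprehension_model v (fun _ => x) (typ x)
  (Eq (BV 0) (FV (typ x) 0)) hv (eqxx _).
rewrite /= vx in hz.
by apply/esym/hz => //; apply/h => //; apply/hz.
Qed.

(** Together with [agree_up], this shows that the level at which two elements are compared is
    immaterial once it exceeds both types. Here z(x) ↔ z(y), as a formula in z, is well-formed at
    both levels and so passes from the higher to the lower. *)
Lemma agree_down x y k l : typ x < k -> typ y < k -> k <= l ->
  agree l x y -> agree k x y.
Proof.
move=> xk yk kl h z tz; have [v [hv vx vy]] := two_params x y inh.
pose p := Iff (Pred (BV 0) (FV (typ x) 0)) (Pred (BV 0) (FV (typ y) 1)).
have := @CTT_down v (fun _ => x) l k p z hv kl; rewrite /p /= vx vy; case=> //; lia.
Qed.

Lemma agree_up x y k l : typ x < k -> typ y < k -> k <= l ->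
  agree k x y -> agree l x y.
Proof.
case: k => // n xk yk kl h z tz.
have [v0 [hv0 _ vz]] := two_params z z inh; rewrite tz in vz.
(* [z'] is the trace of [z] on type n. The biconditional of z'(c) and z(c), known at type n, passes
   down to all lower types, so [z'] at level n+1 can stand in for [z] on both [x] and [y]. *)
have [z' tz' hz'] := @CTT_comprehension_model v0 (fun _ => x) n
  (Pred (FV l 1) (BV 0)) hv0 kl.
rewrite /= vz in hz'.
have [v [hv v1 v2]] := two_params z' z inh; rewrite tz in v2; rewrite tz' in v1.
have down c : typ c <= n -> (pos z' c <-> pos z c).
  move=> cn.
  pose p := Iff (Pred (FV n.+1 0) (BV 0)) (Pred (FV l 1) (BV 0)).
  have := @CTT_down v (fun _ => x) n (typ c) p c hv cn.
  rewrite /p /= v1 v2; case=> //; lia.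
by rewrite -!down //; apply: h.
Qed.

(** If no y of type n agreed with [x], then passing down from type n to the type of [x] would show
    that [x] does not agree with itself. *)
Lemma raise x n : typ x <= n -> exists2 y, typ y = n & agree n.+1 x y.
Proof.
move=> xn; have [v [hv vx _]] := two_params x x inh; apply: contrapT => hN.
pose p := Not (All n.+1 (Iff (Pred (BV 0) (FV (typ x) 0)) (Pred (BV 0) (BV 1)))).
have := @CTT_down v (fun _ => x) n (typ x) p x hv xn.
rewrite /p /= vx; apply=> //; try lia.
move=> d td h; apply: hN; exists d => // z tz; exact: h.
Qed.

Definition ctt_up x : M := s2val (cid2 (raise (leqnSn (typ x)))).

Lemma typ_ctt_up x : typ (ctt_up x) = (typ x).+1.
Proof. by rewrite /ctt_up; case: cid2. Qed.

Lemma agree_ctt_up x : agree (typ x).+2 x (ctt_up x).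
Proof. by rewrite /ctt_up; case: cid2. Qed.
Arguments agree_ctt_up x : clear implicits.

Lemma ctt_upP x y : typ y = (typ x).+1 -> agree (typ x).+2 x y <-> y = ctt_up x.
Proof.
move=> ty; split=> [h|->]; last exact: agree_ctt_up.
apply: agree_eq; rewrite ?typ_ctt_up // ty.
exact: (agree_trans (agree_sym h) (agree_ctt_up x)).
Qed.

Lemma ctt_up_inj x y : ctt_up x = ctt_up y -> x = y.
Proof.
move=> e; have [exy] : (typ x).+1 = (typ y).+1 by rewrite -!typ_ctt_up e.
(* Both [x] and [y] agree with their common image at level [(typ x).+2]; equality needs agreement
   one level lower. *)
apply: (agree_eq exy); apply: (@agree_down _ _ _ (typ x).+2); rewrite -?exy //.
apply: (agree_trans (agree_ctt_up x)); rewrite e exy.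
exact: (agree_sym (agree_ctt_up y)).
Qed.

Lemma pos_agree x y y' : typ x < typ y -> typ y <= typ y' ->
  agree (typ y').+1 y y' -> (pos y x <-> pos y' x).
Proof.
move=> xy yy' h; have [v0 [hv0 vx _]] := two_params x x inh.
have xy' : typ x < typ y' by lia.
(* [z] collects the w of the type of [y'] with w(x). Passing down to the type of [y], z(y) still
   expresses y(x), and agreement of [y] with [y'] at the level of [z] carries this to [y']. *)
have [z tz hz] := @CTT_comprehension_model v0 (fun _ => x) (typ y')
  (Pred (BV 0) (FV (typ x) 0)) hv0 xy'.
rewrite /= vx in hz.
have [v [hv vz v1]] := two_params z x inh; rewrite tz in vz.
pose p := Iff (Pred (FV (typ y').+1 0) (BV 0)) (Pred (BV 0) (FV (typ x) 1)).
have : pos z y <-> pos y x.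
  have := @CTT_down v (fun _ => x) (typ y') (typ y) p y hv yy'.
  rewrite /p /= vz v1; case=> //; lia.
move=> <-; rewrite (h z tz); exact: hz.
Qed.

Lemma pos_ctt_upl x y : typ x < typ y -> (pos (ctt_up y) x <-> pos y x).
Proof.
move=> xy; rewrite (@pos_agree x y (ctt_up y)) ?typ_ctt_up //.
exact: agree_ctt_up.
Qed.

Lemma pos_ctt_upr x y : (typ x).+1 < typ y -> (pos y (ctt_up x) <-> pos y x).
Proof.
move=> xy; have := agree_ctt_up x; move/(agree_up _ _ xy).
by rewrite typ_ctt_up => /(_ (leqnSn _) (ltnSn _) y erefl) [].
Qed.

Lemma pos_iter_ctt_up j x y : typ x + j < typ y ->
  (pos y (iter j ctt_up x) <-> pos y x).
Proof.
have ti i : typ (iter i ctt_up x) = typ x + i.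
  by elim: i => [|i IH] /=; rewrite ?addn0 // typ_ctt_up IH addnS.
elim: j => //= j IH hj; rewrite pos_ctt_upr ?ti; last by lia.
by apply: IH; lia.
Qed.

End CumulativeModels.

(** * Models of simple type theory with [Up] *)

Section SimpleModels.
Variable M : structure.
Hypothesis M_STT : models M STTup.
Implicit Types x y z w d c : M.

Let inh : inhabited_types M. Proof. by case: M_STT. Qed.

Lemma typ_upS x : typ (upS x) = (typ x).+1.
Proof. by case: M_STT => up_typed _ _; apply: up_typed. Qed.

Lemma typ_iter_upS j x : typ (iter j (@upS M) x) = typ x + j.
Proof. by elim: j => [|j IH] /=; rewrite ?addn0 // typ_upS IH addnS. Qed.

Lemma stt_axiom p : STTup_axiom p -> wf simple_up [::] p ->
  exists v e, typed_params v /\ @holds M v e p.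
Proof.
case: M_STT => _ _ thmM ax wp.
have [v hv] := exists_typed_params inh; have [d _] := inh 0.
by exists v, (fun _ => d); split=> //; apply: thmM => //; apply: Axm.
Qed.

Lemma stt_eq x y : typ x = typ y -> agree (typ x).+1 x y -> x = y.
Proof.
move=> exy h; have [|v [e [_ hv]]] := stt_axiom (STT_identity (typ x)).
  by rewrite /= !eqxx.
have /= [_] := hv x erefl y (esym exy); apply=> z tz.
by have [] := h z tz.
Qed.

Lemma upS_inj : injective (@upS M).
Proof.
move=> x y exy; have [e'] : (typ x).+1 = (typ y).+1 by rewrite -!typ_upS exy.
have [|v [e [_ hv]]] := stt_axiom (Up_Inject (typ x)).
  by rewrite /= !eqxx.
exact: (hv x erefl y (esym e')).
Qed.

Lemma iter_upS_inj j : injective (iter j (@upS M)).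
Proof. by elim: j => [|j IH] x y //= /upS_inj /IH. Qed.

Lemma pos_upS x y : typ y = (typ x).+1 -> pos (upS y) (upS x) <-> pos y x.
Proof.
move=> exy; have [|v [e [_ hv]]] := stt_axiom (Up_Possess (typ x)).
  by rewrite /= !eqxx.
by have := hv x erefl y exy.
Qed.

Lemma pos_iter_upS j x y : typ y = (typ x).+1 ->
  pos (iter j (@upS M) y) (iter j (@upS M) x) <-> pos y x.
Proof.
move=> exy; elim: j => //= j IH.
by rewrite pos_upS // !typ_iter_upS exy.
Qed.

Lemma up_founded x y : 0 < typ x -> typ y = typ x -> pos (upS y) x ->
  exists z, x = upS z.
Proof.
case tx: (typ x) => [|n] // _ ty h.
have [|v [e [_ hv]]] := stt_axiom (Up_Founded n).
  by rewrite /= !eqxx.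
by have [z _ ez] := hv x tx y ty h; exists z.
Qed.

Lemma up_base x y : typ x = 0 -> typ y = 0 -> ~ pos (upS y) x.
Proof.
move=> tx ty; have [|v [e [_ hv]]] := stt_axiom Up_Base.
  by rewrite /=.
exact: hv x tx y ty.
Qed.

(** Up-Founded shows that x is some ↑x', and Up-Possess then cancels one ↑ on each side; repeat. *)
Lemma iter_up_founded j n x y : typ y = n.+1 -> typ x = n + j.+1 ->
  pos (iter j.+1 (@upS M) y) x -> exists z, x = iter j.+1 (@upS M) z.
Proof.
move=> ty; elim: j x => [|j IH] x tx h.
  by apply: up_founded h; lia.
have [|||x' ex] := @up_founded x (iter j.+1 (@upS M) y); rewrite ?typ_iter_upS //; try lia.
subst x; rewrite typ_upS in tx.
have [||z ->] := IH x'; first by lia.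
- by apply: (proj1 (@pos_upS x' (iter j.+1 (@upS M) y) _) h); rewrite typ_iter_upS; lia.
- by exists z.
Qed.

(** The same peeling lowers x to type 0, where Up-Base applies. *)
Lemma iter_up_base j x y : typ y = 0 -> typ x = j ->
  ~ pos (iter j.+1 (@upS M) y) x.
Proof.
move=> ty; elim: j x => [|j IH] x tx h; first exact: up_base h.
have [|||x' ex] := @up_founded x (iter j.+1 (@upS M) y); rewrite ?typ_iter_upS //; try lia.
subst x; rewrite typ_upS in tx; case: tx => tx.
apply: (IH x') => //.
by apply: (proj1 (@pos_upS x' (iter j.+1 (@upS M) y) _) h); rewrite typ_iter_upS; lia.
Qed.

(** The truncated difference has its intended value when [typ c < typ d], which is the well-formed
    case of the cumulative discipline. *)
Definition cpos d c := pos d (iter (typ d - typ c).-1 (@upS M) c).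
Definition stt_cumulative := restructure (@upS M) cpos.
Notation N := stt_cumulative.

Definition raised c d := exists j, d = iter j (@upS M) c.

(** Whatever the number of arrows already on c', [cpos] fills up to one type below d'. Raising d by
    i therefore puts i further arrows on both sides, which Up-Possess removes. *)
Lemma cpos_raised d c d' c' : raised d d' -> raised c c' ->
  typ c < typ d -> typ c' < typ d' -> cpos d' c' = cpos d c.
Proof.
move=> [i ->] [j ->]; rewrite /cpos !typ_iter_upS => lt lt'.
rewrite -iterD; have -> : (typ d + i - (typ c + j)).-1 + j = i + (typ d - typ c).-1 by lia.
rewrite iterD; apply/propext/pos_iter_upS.
by rewrite typ_iter_upS; lia.
Qed.

Lemma eq_raised a b a' b' : raised a a' -> raised b b' -> typ a = typ b ->
  typ a' = typ b' -> (a' = b') = (a = b).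
Proof.
move=> [i ->] [j ->]; rewrite !typ_iter_upS => e /eqP.
rewrite e eqn_add2l => /eqP->; apply/propext; split=> [|-> //].
exact: iter_upS_inj.
Qed.

(** Two environments are needed for the induction: under a quantifier both receive the same new
    element, raised zero times. Cumulative terms contain no ↑, so values of terms inherit the
    relation, and well-formedness in both environments supplies the type conditions of [cpos_raised]
    and [eq_raised]. *)
Lemma holds_raised (v : nat -> nat -> N) p G G' (e e' : nat -> N) :
  typed_params v -> typed_env G e -> typed_env G' e' -> size G = size G' ->
  (forall k, k < size G -> raised (e k) (e' k)) ->
  wf cumulative G p -> wf cumulative G' p -> holds v e' p = holds v e p.
Proof.
move=> hv.
have tt G0 (e0 : nat -> N) t : typed_env G0 e0 -> wft cumulative G0 t ->
    @typ M (tval v e0 t) = ty G0 t.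
  by move=> he wt; apply: (@typ_tval N cumulative).
have rr G0 (e0 e1 : nat -> N) t : (forall k, k < size G0 -> raised (e0 k) (e1 k)) ->
    wft cumulative G0 t -> raised (tval v e0 t) (tval v e1 t).
  by move=> h; case: t => //= n i _; exists 0.
elim: p G G' e e' => //= [t s|t s|p IHp q IHq|p IHp q IHq|p IHp q IHq|n p IHp|n p IHp]
  G G' e e' he he' eG h.
- move=> /and3P[wt ws lt] /and3P[wt' ws' lt'].
  by apply: cpos_raised; rewrite ?(tt G e) ?(tt G' e') //; apply: (rr G).
- move=> /and3P[wt ws /eqP lt] /and3P[wt' ws' /eqP lt'].
  by apply: eq_raised; rewrite ?(tt G e) ?(tt G' e') //; apply: (rr G).
1,2,3: by move=> /andP[w1 w2] /andP[w1' w2'];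
  rewrite (IHp _ _ _ _ he he' eG h w1 w1') (IHq _ _ _ _ he he' eG h w2 w2').
all: move=> w w';
  have IH d : typ d = n -> holds v (scons d e') p = holds v (scons d e) p.
1,3: by move=> td; apply: (IHp (n :: G) (n :: G')) => //=;
  [exact: typed_scons|exact: typed_scons|rewrite eG|case=> [|k] //=; [exists 0|apply: h]].
- by apply: eq_forall => d; apply: eq_forall => td; rewrite IH.
- by apply/propext; split=> -[d td hd]; exists d => //; move: hd; rewrite IH.
Qed.

Lemma stt_cumulative_coherent : coherent N cumulative.
Proof.
move=> m n a le ta; exists (iter (n - m) (@upS M) a).
  by rewrite [LHS]typ_iter_upS -[typ a]/(@typ N a) ta; apply: subnKC.
move=> v e p hv wm wn; apply: (@holds_raised _ _ [:: m] [:: n]) => //.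
- by case.
- by case=> //= _; rewrite [LHS]typ_iter_upS -[typ a]/(@typ N a) ta; apply: subnKC.
- by case=> //= _; exists (n - m).
Qed.

End SimpleModels.

(** * The two interpretations *)

Definition into_cumulative : translation :=
  Translation (fun _ _ => Pred (BV 1) (BV 0))
              (fun n => Equiv n n.+1 (BV 1) (BV 0)).

(* [CTTomega] has no [Up], so the second component is never used. *)
Definition into_simple : translation :=
  Translation (fun n m => Pred (BV 1) (iter (n - m).-1 Up (BV 0)))
              (fun _ => Bot).

Lemma wf_into_cumulative_iup n :
  wf cumulative [:: n.+1; n] (Equiv n n.+1 (BV 1) (BV 0)).
Proof. by rewrite /=; lia. Qed.

Lemma wf_into_cumulative G p : wf simple_up G p ->
  wf cumulative G (tr into_cumulative G p).
Proof.
apply: wf_tr => [n m /= /eqP-> //|_ n]; exact: wf_into_cumulative_iup.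
Qed.

Lemma wf_into_simple_ipred n m : m < n ->
  wf simple_up [:: m; n] (ipred into_simple n m).
Proof.
have h k : wft simple_up [:: m; n] (iter k Up (BV 0)) /\
           ty [:: m; n] (iter k Up (BV 0)) = m + k.
  by elim: k => [|k [h1 h2]] /=; rewrite ?addn0 // h1 h2 addnS.
by move=> lt; case: (h (n - m).-1) => /= -> ->; rewrite /=; lia.
Qed.

Lemma wf_into_simple G p : wf cumulative G p ->
  wf simple_up G (tr into_simple G p).
Proof. by apply: wf_tr => // n m; apply: wf_into_simple_ipred. Qed.

Lemma CTT_axiom_psub s p : typed_psub cumulative s -> CTT_axiom p ->
  CTT_axiom (psub s p).
Proof.
move=> hs [n q wq|m n|m].
- exact: (@CTT_comprehension n (psub s q) (wf_psub hs wq)).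
- exact: Type_Founded.
- exact: Type_Base.
Qed.

Lemma STTup_axiom_psub s p : typed_psub simple_up s -> STTup_axiom p ->
  STTup_axiom (psub s p).
Proof.
move=> hs [n q wq|n|n|n|n|].
- exact: (@STT_comprehension n (psub s q) (wf_psub hs wq)).
- exact: STT_identity.
- exact: Up_Inject.
- exact: Up_Possess.
- exact: Up_Founded.
- exact: Up_Base.
Qed.

Lemma CTT_completeness p : wf cumulative [::] p ->
  (forall (M : structure) (v : nat -> nat -> M) e, models M CTTomega ->
     typed_params v -> holds v e p) ->
  thm CTTomega p.
Proof. exact: (@completeness CTTomega p leqnn CTT_axiom_psub). Qed.

Lemma STTup_completeness p : wf simple_up [::] p ->
  (forall (M : structure) (v : nat -> nat -> M) e, models M STTup ->
     typed_params v -> holds v e p) ->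
  thm STTup p.
Proof. exact: (@completeness STTup p (@eqxx _) STTup_axiom_psub). Qed.

Lemma simple_coherent (M : structure) : coherent M simple_up.
Proof. by move=> m n a /eqP <- ta; exists a. Qed.

(** * From a cumulative model to a simple one *)

Section FromCumulative.
Variable M : structure.
Hypothesis M_CTT : models M CTTomega.

Definition ctt_simple := restructure (ctt_up M_CTT) (@pos M).
Notation N := ctt_simple.

Lemma ctt_simple_up_typed L : up_typed N L.
Proof. by move=> _ d; apply: typ_ctt_up. Qed.

Lemma holds_Equiv_succ (v : nat -> nat -> M) e n x y : typ x = n ->
  typ y = n.+1 ->
  holds v (scons y (scons x e)) (iup into_cumulative n) =
    (y = ctt_up M_CTT x).
Proof.
move=> tx ty; apply/propext; rewrite holds_Equiv (maxn_idPr (leqnSn n)) /=.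
by rewrite -(ctt_upP M_CTT) tx.
Qed.

Lemma holds_into_cumulative (v : nat -> nat -> M) G e p : typed_params v ->
  wf simple_up G p -> typed_env G e ->
  holds v e (tr into_cumulative G p) = @holds N v e p.
Proof.
move=> hv; apply: holds_tr => //; first exact: ctt_simple_up_typed.
by move=> _ n v' e' x y _; apply: holds_Equiv_succ.
Qed.

Lemma ctt_simple_validates : validates N STTup_axiom.
Proof.
move=> v e p hv [n q wq|n|n|n|n|] /=.
- have w := wf_into_cumulative wq.
  have [] := @models_comprehension M CTTomega v e n _ M_CTT (ltnSn _) _ w hv.
    exact: CTT_comprehension.
  move=> z tz hz; exists z => // x tx.
  by have [] := hz x tx; rewrite holds_into_cumulative //; apply: typed_env1.
- move=> x tx y ty; split=> [-> z _|h]; first by split.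
  apply: (agree_eq M_CTT); first by rewrite tx ty.
  by move=> z; rewrite tx => /h.
- by move=> x tx y ty; apply: ctt_up_inj.
- move=> x tx y ty.
  rewrite /= in tx ty.
  (* The arrow on the argument is removed first: y and ↑x have the same type, so removing the one on
     y first would leave an ill-formed predication. *)
  apply: (@iff_trans _ (pos (ctt_up M_CTT y) x)).
    by apply: pos_ctt_upr; rewrite typ_ctt_up tx ty.
  by apply: pos_ctt_upl; rewrite tx ty.
- move=> x tx y ty h; have [_ _ thmM] := M_CTT.
  have d : thm CTTomega (All n.+1 (All n.+1 (Imp (HatIn n.+1 n.+1 (BV 1) (BV 0))
      (Ex n (Equiv n.+1 n (BV 2) (BV 0)))))).
    by apply: Axm; [exact: Type_Founded | rewrite /=; lia].
  (* ↑y witnesses x ∈̂ y, since ↑y ≡ y and ↑y(x). Type-Founded then gives z of type n with x ≡ z,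
     which means x = ↑z. *)
  have hat : @holds M v (scons y (scons x e)) (HatIn n.+1 n.+1 (BV 1) (BV 0)).
    apply/holds_HatIn; exists (ctt_up M_CTT y).
      by rewrite typ_ctt_up maxnn -ty.
    split=> //=; rewrite maxnn -ty; apply: agree_sym; exact: agree_ctt_up.
  have [z tz /holds_Equiv hz] := thmM _ v e hv d x tx y ty hat.
  exists z => //; rewrite (maxn_idPl (leqnSn n)) /= in hz.
  apply/ctt_upP; rewrite ?tz //.
  by apply: agree_sym.
- move=> x tx y ty h; have [_ _ thmM] := M_CTT.
  have d : thm CTTomega (All 0 (All 0 (Not (HatIn 0 0 (BV 0) (BV 1))))).
    by apply: Axm; [exact: Type_Base |].
  apply: (thmM _ v e hv d y ty x tx); apply/holds_HatIn.
  exists (ctt_up M_CTT y); first by rewrite typ_ctt_up -[typ y]/(@typ N y) ty.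
  split=> //=; rewrite max0n (_ : 0 = @typ M y) //.
  by apply: agree_sym; apply: agree_ctt_up.
Qed.

End FromCumulative.

(** * From a simple model to a cumulative one *)

Section FromSimple.
Variable M : structure.
Hypothesis M_STT : models M STTup.
Notation N := (stt_cumulative M).
Implicit Types x y z w d c : M.

Lemma cpos_succ d c : typ d = (typ c).+1 -> cpos d c = pos d c.
Proof. by rewrite /cpos => ->; rewrite subSnn. Qed.

Lemma raised_refl c : raised c c.
Proof. by exists 0. Qed.

Lemma tval_iter_Up (v : nat -> nat -> M) e j t :
  tval v e (iter j Up t) = iter j (@upS M) (tval v e t).
Proof. by elim: j => //= j ->. Qed.

Lemma holds_into_simple (v : nat -> nat -> M) G e p : typed_params v ->
  wf cumulative G p -> typed_env G e ->
  holds v e (tr into_simple G p) = @holds N v e p.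
Proof.
move=> hv; apply: holds_tr => // n m v' e' d c _ _ td tc.
by rewrite /= tval_iter_Up /cpos td tc.
Qed.

(** In the constructed model, [b] is indiscernible from its raisings, so [z] and the raising of [b]
    to type k satisfy the same predicates of type k+1. The identity scheme then makes them equal. *)
Lemma cumulative_agree_eq k z b : typ z = k -> typ b <= k ->
  @agree N k.+1 z b -> z = iter (k - typ b) (@upS M) b.
Proof.
move=> tz tb h; apply: (stt_eq M_STT).
  by rewrite typ_iter_upS // subnKC.
move=> w; rewrite tz => tw.
have ti : typ (iter (k - typ b) (@upS M) b) = k by rewrite typ_iter_upS // subnKC.
rewrite -!cpos_succ ?ti ?tz //.
have rb : raised b (iter (k - typ b) (@upS M) b) by exists (k - typ b).
by rewrite (cpos_raised M_STT (raised_refl w) rb) ?ti ?tw //; apply: h.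
Qed.

Lemma stt_cumulative_validates : validates N CTT_axiom.
Proof.
move=> v e p hv [n q wq|m n|m].
- have w := wf_into_simple wq.
  have [] := @models_comprehension M STTup v e n _ M_STT (eqxx _) _ w hv.
    exact: STT_comprehension.
  move=> z tz hz; exists z => // x tx.
  have [] := hz x tx; rewrite holds_into_simple //; last exact: typed_env1.
  move=> h1 h2.
  have e1 : cpos z x = pos z x by apply: cpos_succ; rewrite tz -tx.
  by split; rewrite /= e1.
- move=> a ta b tb /holds_HatIn[z tz [hz hp]].
  rewrite /= in ta tb tz hz hp.
  (* An element and its raising satisfy the same predicates of any type above both, by
     [cpos_raised]. So it suffices to find c of type n related to [a] by raising, in either
     direction. *)
  suff [c tc hc] : exists2 c, typ c = n & @raised M a c \/ @raised M c a.
    exists c => //; apply/holds_Equiv => w tw; rewrite /= in tw.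
    have wa : typ a < typ w by rewrite tw ta ltnS leq_maxl.
    have wc : typ c < typ w by rewrite tw tc ltnS leq_maxr.
    have e1 : @cpos M w a = @cpos M w c.
      case: hc => hc; last exact: (cpos_raised M_STT (raised_refl w) hc wc wa).
      exact/esym/(cpos_raised M_STT (raised_refl w) hc wa wc).
    by rewrite /= e1.
  case: (leqP m n) => [le|lt].
    exists (iter (n - m) (@upS M) a); last by left; exists (n - m).
    by rewrite typ_iter_upS // ta subnKC.
  (* Now z = ↑^{m-n} b contains [a], so Up-Founded, iterated, writes [a] as ↑^{m-n} c; the exponent
     is positive because n < m. *)
  have ek : maxn m n.+1 = m by lia.
  rewrite ek in tz hz.
  have ez := cumulative_agree_eq tz _ hz.
  rewrite cpos_succ ?tz ?ta // ez ?tb in hp; last by lia.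
  rewrite subSS (_ : m - n = (m - n.+1).+1) in hp; last by lia.
  have [|c ec] := iter_up_founded M_STT tb _ hp; first by lia.
  exists c; last by right; exists (m - n.+1).+1.
  by move: ta; rewrite ec typ_iter_upS //; lia.
- move=> x tx y ty /holds_HatIn[z tz [hz hp]].
  rewrite /= in tx ty tz hz hp.
  rewrite maxn0 in tz hz.
  have ez := cumulative_agree_eq tz _ hz.
  rewrite cpos_succ ?tz ?ty // ez ?tx // subn0 in hp.
  exact: (iter_up_base M_STT tx ty hp).
Qed.

End FromSimple.

(** * Correctness of the interpretations and round trips *)

Lemma into_cumulative_interpretation :
  interpretation STTup CTTomega into_cumulative.
Proof.
split=> [n m /= /eqP->|_ n|p wp dp].
- by split=> //=; rewrite ltnSn.
- split; first by split; [exact: wf_into_cumulative_iup|].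
  apply: CTT_completeness => [|M v e hM hv x tx]; first by rewrite /=; lia.
  exists (ctt_up hM x); first by rewrite typ_ctt_up tx.
  have up_x y : typ y = n.+1 ->
    holds v (scons y (scons x e)) (iup into_cumulative n) = (y = ctt_up hM x).
    exact: holds_Equiv_succ.
  split.
    suff h : holds v (scons (ctt_up hM x) (scons x e)) (iup into_cumulative n) by exact: h.
    by rewrite up_x // typ_ctt_up tx.
  move=> y ty.
  change (holds v (scons y (scons (ctt_up hM x) (scons x e)))
            (lift1 (iup into_cumulative n)) -> y = ctt_up hM x).
  by rewrite holds_lift1 up_x.
- apply: CTT_completeness => [|M v e hM hv]; first exact: wf_into_cumulative.
  rewrite (holds_into_cumulative hM) //.
  apply: (soundness (L := simple_up) (Ax := STTup_axiom) (D := [::])) => //.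
  + exact: ctt_simple_up_typed.
  + exact: simple_coherent.
  + exact: ctt_simple_validates.
Qed.

Lemma into_simple_interpretation :
  interpretation CTTomega STTup into_simple.
Proof.
split=> // [n m lt|p wp dp].
  split; first exact: wf_into_simple_ipred.
  by rewrite /=; elim: (n - m).-1.
apply: STTup_completeness => [|M v e hM hv]; first exact: wf_into_simple.
rewrite holds_into_simple //.
apply: (soundness (L := cumulative) (Ax := CTT_axiom) (D := [::])) => //.
- exact: stt_cumulative_coherent.
- exact: stt_cumulative_validates.
Qed.

(** In the cumulative model built from M, ≡ between types n and n+1 is the graph of the original ↑
    ([iupE]), and [cpos] between adjacent types is the original predication. The second construction
    therefore restores M. *)
Lemma STTup_round_trip : round_trip STTup into_cumulative into_simple.
Proof.
have iupE M (hM : models M STTup) n (v : nat -> nat -> M) e x y :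
    typ x = n -> typ y = n.+1 ->
    @holds (stt_cumulative M) v (scons y (scons x e)) (iup into_cumulative n) =
    (y = upS x).
  move=> tx ty; apply/propext; rewrite holds_Equiv (maxn_idPr (leqnSn n)) /=.
  split=> [h|->].
    have := @cumulative_agree_eq _ hM n.+1 y x ty; rewrite tx subSnn => -> //.
    exact: agree_sym.
  move=> w; rewrite /= => tw; have rx : @raised M x (upS x) by exists 1.
  by rewrite (cpos_raised hM (raised_refl w) rx) // ?typ_upS // tw tx.
split=> [p wp|_ n].
  apply: STTup_completeness => [|M v e hM hv].
    by rewrite /= wp wf_into_simple // wf_into_cumulative.
  suff e1 : holds v e (tr into_simple [::] (tr into_cumulative [::] p)) = holds v e p.
    by rewrite /= e1.
  rewrite holds_into_simple //; last exact: wf_into_cumulative.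
  (* M is presented as a restructuring of [stt_cumulative M] by its own [upS] and [pos], so that
     [holds_tr] applies with the cumulative model as its base. *)
  rewrite -(holds_restructure_id (M := M)).
  apply: (@holds_tr simple_up into_cumulative (stt_cumulative M) (@upS M) (@pos M)) => //.
  - by move=> _ d; apply: (typ_upS hM).
  - move=> n m v' e' d c /eqP-> _ td tc /=.
    by apply: cpos_succ; rewrite [LHS]td -[typ c]/(@typ (stt_cumulative M) c) tc.
  - by move=> _ n v' e' x y _; apply: iupE.
have w := wf_into_simple (wf_into_cumulative_iup n).
apply: STTup_completeness => [|M v e hM hv x tx y ty].
  by apply/andP; split; apply/andP; split; rewrite ?w //= ?eqxx.
suff e1 : upS x = y <-> holds v (scons y (scons x e))
    (tr into_simple [:: n.+1; n] (iup into_cumulative n)) by exact: e1.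
rewrite holds_into_simple ?iupE //; first by split=> ->.
- exact: wf_into_cumulative_iup.
- by case=> [|[|]].
Qed.

(** The doubly translated predication says y(↑^{n-m-1} x) with ↑ read as [ctt_up], and
    [pos_iter_ctt_up] reduces this to y(x). *)
Lemma CTTomega_round_trip : round_trip CTTomega into_simple into_cumulative.
Proof.
split=> // p wp; apply: CTT_completeness => [|M v e hM hv].
  by rewrite /= wp wf_into_cumulative // wf_into_simple.
suff e1 : holds v e (tr into_cumulative [::] (tr into_simple [::] p)) = holds v e p.
  by rewrite /= e1.
rewrite (holds_into_cumulative hM) //; last exact: wf_into_simple.
rewrite -(holds_restructure_id (M := M)).
apply: (@holds_tr cumulative into_simple (ctt_simple hM) (@upS M) (@pos M)) => //.
move=> n m v' e' d c lt _ td tc; rewrite /= tval_iter_Up /=.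
apply/propext/pos_iter_ctt_up.
rewrite -[typ c]/(@typ (ctt_simple hM) c) -[typ d]/(@typ (ctt_simple hM) d) tc td.
by rewrite /= in lt; lia.
Qed.

Theorem theoremC7 : definitionally_equivalent STTup CTTomega.
Proof.
exists into_cumulative, into_simple; split.
- exact: into_cumulative_interpretation.
- exact: into_simple_interpretation.
- exact: STTup_round_trip.
- exact: CTTomega_round_trip.
Qed.
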